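(* Let $G$ be a connected graph of order $n$ with stability number $\alpha$ (so $1\le\alpha\le n-1$ when $n\ge 2$). Then \[ F(G) \le f_{\mathsf{TC}}(n,\alpha). \] If $(n,\alpha)\ne(5,2)$, equality holds if and only if $G \simeq TC_{n,\alpha}$; if $(n,\alpha)=(5,2)$, equality holds if and only if $G\simeq TC_{5,2}$ or $G \simeq C_5$ (the cycle on 5 vertices).
   Context: All graphs are finite, simple and undirected; $\alpha(G)$ denotes the stability number. The Fibonacci index $F(G)$ is the number of stable sets of $G$, including the empty set. For integers $1\le \alpha\le n$, the Turán graph $T_{n,\alpha}$ is the disjoint union of $\alpha$ cliques whose orders sum to $n$ and differ pairwise by at most one (each of order $\lceil n/\alpha\rceil$ or $\lfloor n/\alpha\rfloor$). For $1\le\alpha\le n-1$, the Turán-connected graph $TC_{n,\alpha}$ is obtained from $T_{n,\alpha}$ by choosing a vertex $v$ in one clique of order $\lceil n/\alpha\rceil$ and adding $\alpha-1$ edges joining $v$ to one vertex of each of the other $\alpha-1$ cliques; it is connected, unique up to isomorphism, of order $n$ and stability number $\alpha$. Define $f_{\mathsf{TC}}(n,\alpha)=F(TC_{n,\alpha})$. *)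

(* Defs.v *)
(* Simple graphs = symmetric irreflexive boolean relations on a finType. *)
From mathcomp Require Import all_boot.
Set Implicit Arguments. Unset Strict Implicit. Unset Printing Implicit Defensive.

Definition stable (T : finType) (G : rel T) (S : {set T}) : bool :=
  [forall x in S, forall y in S, ~~ G x y].

Definition fib_index (T : finType) (G : rel T) : nat :=
  #|[set S : {set T} | stable G S]|.

Definition stability_number (T : finType) (G : rel T) : nat :=
  \max_(S : {set T} | stable G S) #|S|.

Definition connected_graph (T : finType) (G : rel T) : Prop :=
  forall x y : T, connect G x y.

Definition graph_iso (T T' : finType) (G : rel T) (G' : rel T') : Prop :=
  exists f : T -> T', bijective f /\ forall x y : T, G' (f x) (f y) = G x y.

(* Turán-connected graph TC_{n,a} on 'I_n:
   vertex i lies in clique number (i mod a); the clique sizes are then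
   ceil(n/a) or floor(n/a), and clique 0 has size ceil(n/a).
   v := vertex 0 (in clique 0) is joined to vertex j (in clique j) for 0 < j < a. *)
Definition TC_graph (n a : nat) : rel 'I_n :=
  fun x y : 'I_n => (x != y) &&
    [|| ((x : nat) %% a == (y : nat) %% a),
        (((x : nat) == 0) && (0 < (y : nat)) && ((y : nat) < a)) |
        (((y : nat) == 0) && (0 < (x : nat)) && ((x : nat) < a))].

Arguments TC_graph : clear implicits.

Definition f_TC (n a : nat) : nat := fib_index (TC_graph n a).

Definition cycle_graph (n : nat) : rel 'I_n :=
  fun x y : 'I_n => (x != y) && (((x : nat).+1 %% n == (y : nat)) || ((y : nat).+1 %% n == (x : nat))).
Arguments cycle_graph : clear implicits.

(* Main.v *)
Require Import Defs.
From mathcomp Require Import all_boot zify.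
Set Implicit Arguments. Unset Strict Implicit. Unset Printing Implicit Defensive.

(** For a vertex x, F(G) = F(G - x) + F(G - N[x]).  With x a vertex of maximum degree this gives
    F(G) <= F(T_{n,a}) for every graph of stability number at most a, with equality only for the
    Turan graph.

    For connected graphs, argue by induction on the order and then on the number of edges.
    If some edge can be deleted without increasing the stability number, either the graph stays
    connected, and F strictly increases, or the edge x1x2 is a bridge between G1 and G2.  In the
    latter case F(G) = F(G1 - x1) F(G2) + F(G1 - N[x1]) F(G2 - x2) is largest when both G_i are
    Turan-connected with hub x_i, and rerouting the edges of the hub with the smaller clique to
    the other hub does not decrease F.  Otherwise G is alpha-critical, so it has no cut vertex;
    if x has maximum degree d, then either d >= ceil(n/a), and the recursion gives a strict
    inequality, or n = a d + 1, and equality makes G - x extremal, which by a degree count only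
    happens for a = d = 2, i.e. for C_5.

    In the case of equality other than C_5 there is thus a hub x such that G - x is a Turan
    graph, and counting the stable sets of G - N[x] forces G to be Turan-connected. *)

(** * Balanced products *)

(** The largest product of [b] naturals with sum [m], attained when the parts differ by at most one.
    The conventions for division by 0 make it 1 for [b = 0]. *)
Definition balprod m b := (m %/ b) ^ (b - m %% b) * (m %/ b).+1 ^ (m %% b).

(** The number of stable sets of the Turan graph: a clique of order s contributes a factor s + 1,
    and these [a] factors sum to [n + a]. *)
Definition turan n a := balprod (n + a) a.

(** The number of stable sets of the Turan-connected graph, split by whether they contain the hub.
    Without the hub the graph is T_{n-1,a}. Taking the hub excludes its own clique, of order
    [(n.-1 %/ a).+1], and one vertex of every other clique, so that a clique of order s is left with
    s stable sets. *)
Definition tconn n a := turan n.-1 a + balprod (n - (n.-1 %/ a).+1) a.-1.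

Lemma balprodE q b t : t <= b -> balprod (q * b + t) b = q ^ (b - t) * q.+1 ^ t.
Proof.
case: b => [|b] tb; first by move: tb; rewrite leqn0 => /eqP ->; rewrite muln0.
move: tb; rewrite leq_eqVlt => /orP[/eqP ->|tb]; last first.
  by rewrite /balprod divnMDl // divn_small // addn0 modnMDl modn_small.
rewrite -mulSnr /balprod mulnK // modnMl !subn0 subnn.
by rewrite mulnC.
Qed.

Lemma turanE q a t : t <= a -> turan (q * a + t) a = q.+1 ^ (a - t) * q.+2 ^ t.
Proof. by move=> ta; rewrite /turan addnAC -mulSnr balprodE. Qed.

(** Dividing [n - 1] instead of [n] makes the quotient one less than the ceiling of n/a, which is
    the order of the hub's clique without the hub. *)
Lemma posn_decomp n a : 0 < n -> 0 < a ->
  exists2 u, u < a & n = n.-1 %/ a * a + u.+1.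
Proof.
move=> n0 a0; exists (n.-1 %% a); first by rewrite ltn_mod.
by rewrite addnS -divn_eq prednK.
Qed.

Lemma balprodn0 m : balprod m 0 = 1.
Proof. by rewrite /balprod sub0n exp1n. Qed.

Lemma balprodS_le m b : balprod m b <= balprod m.+1 b.
Proof.
case: b => [|b]; first by rewrite !balprodn0.
rewrite (divn_eq m b.+1); have := ltn_pmod m (ltn0Sn b).
move: (m %/ _) (m %% _) => q t tb.
rewrite -addnS !balprodE //; last exact: ltnW.
rewrite subSn // subSS !expnS -mulnA [leqRHS]mulnCA.
exact: leq_mul (leqnSn q) (leqnn _).
Qed.

Lemma balprod_le m m' b : m <= m' -> balprod m b <= balprod m' b.
Proof.
move/subnKC <-; elim: (m' - m) => [|d IH]; first by rewrite addn0.
by rewrite addnS (leq_trans IH) ?balprodS_le.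
Qed.

(** For [b > m + 1] both balanced products contain a zero part and vanish, hence the bound on
    [b]. *)
Lemma balprodS_lt m b : 0 < b <= m.+1 -> balprod m b < balprod m.+1 b.
Proof.
case: b => [|b] //= bm.
have := divn_eq m b.+1; have := ltn_pmod m (ltn0Sn b).
move: (m %/ _) (m %% _) => q t tb mE; rewrite mE.
rewrite -addnS !balprodE //; last exact: ltnW.
rewrite subSn // subSS !expnS -mulnA [ltnRHS]mulnCA ltn_pmul2r //.
have [->|q_gt0] : b - t = 0 \/ 0 < q.
- case: q mE => [|q] mE; last by right.
  by left; lia.
- by rewrite muln_gt0 !expn_gt0 orbT.
- by rewrite muln_gt0 !expn_gt0 q_gt0.
Qed.

Lemma balprod_lt m m' b : m < m' -> 0 < b <= m' -> balprod m b < balprod m' b.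
Proof.
case: m' => // m'; rewrite ltnS => mm' bm.
by apply: leq_ltn_trans (balprod_le _ mm') (balprodS_lt _).
Qed.

Lemma turan_le m m' a : m <= m' -> turan m a <= turan m' a.
Proof. by move=> mm; apply: balprod_le; rewrite leq_add2r. Qed.

Lemma turan_lt m m' a : m < m' -> 0 < a -> turan m a < turan m' a.
Proof. by move=> mm a0; apply: balprod_lt; rewrite ?ltn_add2r // a0 leq_addl. Qed.

(** Bernoulli's inequality (1 + 1/q)^j >= 1 + j/q, cleared of denominators. It is the part x = q + j
    of the tangent bound. *)
Lemma mul_expn_le_up q j : (q + j) * q ^ j <= q * q.+1 ^ j.
Proof.
elim: j => [|j IH]; first by rewrite addn0.
rewrite !expnS; have -> : q * (q.+1 * q.+1 ^ j) = q.+1 * (q * q.+1 ^ j) by lia.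
apply: leq_trans (leq_mul (leqnn q.+1) IH); rewrite !mulnA leq_mul //; nia.
Qed.

(** The part x = q - j of the tangent bound; the induction step rests on (q - j - 1)(q + 1) <= (q -
    j) q. *)
Lemma mul_expn_le_down q j : j <= q -> (q - j) * q.+1 ^ j <= q * q ^ j.
Proof.
elim: j => [|j IH] jq; first by rewrite subn0.
have := IH (ltnW jq); rewrite !expnS => {}IH.
apply: leq_trans (leq_mul (leqnn q) IH); rewrite !mulnA leq_mul //; nia.
Qed.

(* Integer form of the tangent bound x <= q (1 + 1/q)^(x - q), by which balanced products are
   maximal. *)
Lemma mul_expn_le q x : x * q ^ x * q.+1 ^ q <= q ^ q.+1 * q.+1 ^ x.
Proof.
case: (leqP q x) => [/subnKC <-|/ltnW qx].
  move: (x - q) => j; have := mul_expn_le_up q j.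
  rewrite !expnD expnS => H.
  have -> : (q + j) * (q ^ q * q ^ j) * q.+1 ^ q
     = ((q + j) * q ^ j) * (q ^ q * q.+1 ^ q) by lia.
  by apply: leq_trans (leq_mul H (leqnn _)) _; lia.
have := mul_expn_le_down (leq_subr x q); rewrite subKn // => H.
have {3 5}-> : q = x + (q - x) by lia.
rewrite -addnS !expnD expnS.
have -> : x * q ^ x * (q.+1 ^ x * q.+1 ^ (q - x))
     = (x * q.+1 ^ (q - x)) * (q ^ x * q.+1 ^ x) by lia.
by apply: leq_trans (leq_mul H (leqnn _)) _; lia.
Qed.

(** Multiplying the tangent bounds of the entries leaves a bound that depends only on the length and
    the sum of the list. *)
Lemma prod_tangent q (s : seq nat) :
  (\prod_(x <- s) x) * q ^ sumn s * q.+1 ^ (q * size s)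
  <= q ^ (q.+1 * size s) * q.+1 ^ sumn s.
Proof.
elim: s => [|x s IH]; first by rewrite big_nil !muln0.
have := leq_mul (mul_expn_le q x) IH.
rewrite big_cons /= !(mulnS _ (size s)).
move: (q.+1 * size s) (q * size s) => c d.
by rewrite !expnD; congr (_ <= _); lia.
Qed.

(** Take q to be the integer part of the mean. The tangent bound is an equality at both x = q and x
    = q + 1, so its product is exactly the balanced product. *)
Lemma prod_le_balprod (s : seq nat) : \prod_(x <- s) x <= balprod (sumn s) (size s).
Proof.
case: s => [|x0 s0]; first by rewrite big_nil.
move: (x0 :: s0) (isT : 0 < size (x0 :: s0)) => s s_gt0.
have := divn_eq (sumn s) (size s); have := ltn_pmod (sumn s) s_gt0.
move: (sumn s %/ _) (sumn s %% _) => q t tb sE.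
rewrite sE balprodE; last exact: ltnW.
(* For q = 0 the powers of q cannot be cancelled; but then the sum is below the length, so some
   entry is 0. *)
case: (posnP q) => [q0|q_gt0].
  suff -> : \prod_(x <- s) x = 0 by [].
  have : sumn s < size s by lia.
  elim: {s_gt0 tb sE} s => //= x s IH lt_s; rewrite big_cons.
  by case: x lt_s => [//|x] lt_s; rewrite IH ?muln0 //; lia.
have := prod_tangent q s; rewrite {1 2}sE.
have -> : q.+1 * size s = (q * size s + t) + (size s - t) by lia.
rewrite !expnD.
have c_gt0 : 0 < q ^ (q * size s) * q ^ t * q.+1 ^ (q * size s).
  by rewrite !muln_gt0 !expn_gt0 q_gt0.
move=> H; rewrite -(leq_pmul2r c_gt0).
by apply: leq_trans (leq_trans _ H) _; lia.
Qed.

Lemma balprod_seq m b : 0 < b -> exists s,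
  [/\ size s = b, sumn s = m & \prod_(x <- s) x = balprod m b].
Proof.
move=> b_gt0; exists (nseq (b - m %% b) (m %/ b) ++ nseq (m %% b) (m %/ b).+1).
have mb := ltn_pmod m b_gt0.
rewrite size_cat !size_nseq sumn_cat !sumn_nseq big_cat /= !big_nseq.
rewrite !iter_muln_1; split=> //; first lia.
have := divn_eq m b; nia.
Qed.

Lemma balprod_superadd m1 b1 m2 b2 :
  balprod m1 b1 * balprod m2 b2 <= balprod (m1 + m2) (b1 + b2).
Proof.
case: (posnP b1) => [->|b1_gt0].
  by rewrite balprodn0 mul1n balprod_le ?leq_addl.
case: (posnP b2) => [->|b2_gt0].
  by rewrite balprodn0 muln1 addn0 balprod_le ?leq_addr.
have [s1 [<- <- <-]] := balprod_seq m1 b1_gt0.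
have [s2 [<- <- <-]] := balprod_seq m2 b2_gt0.
by rewrite -big_cat -size_cat -sumn_cat prod_le_balprod.
Qed.

Lemma turan_superadd n1 a1 n2 a2 :
  turan n1 a1 * turan n2 a2 <= turan (n1 + n2) (a1 + a2).
Proof. by rewrite /turan addnACA balprod_superadd. Qed.

Lemma leq_expl m n e : m <= n -> m ^ e <= n ^ e.
Proof. by case: e => // e mn; rewrite leq_exp2r. Qed.

Lemma tconnE q a u : u < a ->
  tconn (q * a + u.+1) a
  = q.+1 ^ (a - u) * q.+2 ^ u + q ^ (a.-1 - u) * q.+1 ^ u.
Proof.
case: a => // a ua; rewrite /tconn addnS /= turanE; last exact: ltnW.
rewrite divnMDl // divn_small // addn0 subSS.
have -> : q * a.+1 + u - q = q * a + u by rewrite mulnS -addnA addKn.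
by rewrite balprodE.
Qed.

Lemma turanSE q a u : u < a ->
  turan (q * a + u.+1 - q.+1) a.-1 = q.+1 ^ (a.-1 - u) * q.+2 ^ u.
Proof.
case: a => // a ua; rewrite addnS subSS mulnS -addnA addKn.
by rewrite turanE.
Qed.

Lemma balprodSE q a u : u < a ->
  balprod (q * a + u.+1 - q.+1) a.-1 = q ^ (a.-1 - u) * q.+1 ^ u.
Proof.
case: a => // a ua; rewrite addnS subSS mulnS -addnA addKn.
by rewrite balprodE.
Qed.

Lemma turan_rec n a : 0 < n -> 0 < a ->
  turan n a = turan n.-1 a + turan (n - (n.-1 %/ a).+1) a.-1.
Proof.
move=> n_gt0 a_gt0; have [u ua ->] := posn_decomp n_gt0 a_gt0.
move: (n.-1 %/ a) => q; rewrite addnS /= divnMDl // divn_small // addn0.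
rewrite -addnS turanSE // !turanE ?(ltnW ua) //.
by case: a ua {a_gt0} => // a ua; rewrite subSS (@subSn u a ua) !expnS /=;
  move: (q.+1 ^ (a - u)) (q.+2 ^ u) => x y; lia.
Qed.

(** The left side is what the recursion at x yields when [G - x] obeys the bound with the same
    stability number and x has degree at least [(n.-1 %/ a).+1]. *)
Lemma tconn_step n a : 1 < a < n ->
  tconn n.-1 a + turan (n.-1 - (n.-1 %/ a).+1) a.-1 < tconn n a.
Proof.
case/andP=> a_gt1 an; case: n an => // -[|n] an; first by case: a a_gt1 an => [|[]].
rewrite /tconn (@turan_rec n.+1) //= ?(ltnW a_gt1) //.
set k := n.+1 %/ a; set k' := n %/ a.
(* If the quotient stays the same, the Turan terms agree and the hub terms grow; if it increases by
   one, the hub terms agree and the Turan terms grow. *)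
have [kk'|kk'] : k = k' \/ k = k'.+1.
- rewrite /k /k' divnS ?(ltnW a_gt1) //; case: (_ %| _); [right|left] => //.
- rewrite kk' -!addnA ltn_add2l addnC ltn_add2l.
  apply: balprod_lt.
  + have := leq_divM n.+1 a; rewrite -/k; nia.
  + have := leq_divM n.+1 a; rewrite -/k; nia.
- rewrite kk' !subSS -!addnA ltn_add2l [ltnRHS]addnC ltn_add2l.
  apply: turan_lt.
  + have := leq_divM n.+1 a; rewrite -/k; nia.
  + lia.
Qed.

(** The boundary case n = a D + 1 with maximum degree D, one less than [tconn_step] asks for: here
    the recursion bound is tight and gives no strict inequality. *)
Lemma tconn_step_eq D a : 0 < a -> 0 < D ->
  tconn (a * D) a + turan (a * D - D) a.-1 = tconn (a * D).+1 a.
Proof.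
case: a => // a _; case: D => // D _.
rewrite [a.+1 * D.+1]mulnC -[in RHS]addn1 tconnE //.
have -> : D.+1 * a.+1 = D * a.+1 + a.+1 by rewrite mulSnr.
rewrite tconnE // subnn !subSn ?subnn //= !subn0.
have -> : D * a.+1 + a.+1 - D.+1 = D.+1 * a + 0 by lia.
by rewrite turanE // subn0 !expnS; lia.
Qed.

(** Both sides are products of b - 1 factors, and each factor on the left exceeds its partner by
    one; so there can be no factors at all. *)
Lemma expn_gap q u b : u < b ->
  q.+1 ^ (b.-1 - u) * q.+2 ^ u <= q ^ (b.-1 - u) * q.+1 ^ u -> b = 1.
Proof.
move=> ub; apply: contraTeq => b1; rewrite -ltnNge.
have [u0|u_gt0] := posnP u.
  by rewrite u0 !expn0 !muln1 ltn_exp2r //; lia.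
apply: leq_ltn_trans (_ : _ <= q.+1 ^ (b.-1 - u) * q.+1 ^ u) _.
  by rewrite leq_mul ?leq_expl.
by rewrite ltn_pmul2l ?expn_gt0 // ltn_exp2r.
Qed.

(** Here [h] counts the stable sets of two Turan-connected graphs whose hubs are joined by an edge:
    neither hub, only the first, only the second. Rerouting the edges of the second hub to the
    first, whose clique is at least as large, gives a graph with A1 T2 stable sets avoiding the
    remaining hub and Q1 B2 containing it. These terms are bounded by those of [f] through
    superadditivity ([L] and [M]), and [gap] shows that rerouting loses nothing. *)
Lemma bridge_bound_sorted n1 a1 n2 a2 :
  0 < a1 <= n1 -> 0 < a2 <= n2 -> n2.-1 %/ a2 <= n1.-1 %/ a1 ->
  let A1 := turan n1.-1 a1 in let A2 := turan n2.-1 a2 in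
  let h := A1 * A2 + (tconn n1 a1 - A1) * A2 + (tconn n2 a2 - A2) * A1 in
  let f := tconn (n1 + n2) (a1 + a2) in
  h <= f /\ (h = f ->
   a2 = 1 /\ A1 * turan n2 1 = turan (n1 + n2).-1 (a1 + a2) \/
   a1 = 1 /\ A2 * turan n1 1 = turan (n1 + n2).-1 (a1 + a2)).
Proof.
case/andP=> a1_gt0 an1 /andP[a2_gt0 an2].
have n1_gt0 := leq_trans a1_gt0 an1; have n2_gt0 := leq_trans a2_gt0 an2.
rewrite /= /tconn !addKn; set k := (n1 + n2).-1 %/ _.
have [u1 ua1 E1] := posn_decomp n1_gt0 a1_gt0.
have [u2 ua2 E2] := posn_decomp n2_gt0 a2_gt0.
move: (n1.-1 %/ a1) (n2.-1 %/ a2) E1 E2 => q1 q2 E1 E2 q21.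
(* The average clique order of the union is at most the larger of the two averages. *)
have kq : k <= q1.
  rewrite -ltnS /k ltn_divLR; last by rewrite addn_gt0 a1_gt0.
  by move: E1 E2 q21 ua1 ua2; clear; nia.
clearbody k.
have q1n1 : q1 < n1 by move: E1 a1_gt0; clear; nia.
have nn : n1 - q1.+1 + n2 <= n1 + n2 - k.+1 by move: kq q1n1; clear; lia.
have aa : a1.-1 + a2 = (a1 + a2).-1 by rewrite -[in RHS](prednK a1_gt0).
have nn' : n1.-1 + n2 = (n1 + n2).-1 by rewrite -[in RHS](prednK n1_gt0).
(* [P1] and [P2] count the stable sets of the cliques other than the hub's; [Q1] and [Q2] do so
   after each of these cliques has lost its neighbour of the hub. *)
pose P1 := q1.+1 ^ (a1.-1 - u1) * q1.+2 ^ u1.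
pose P2 := q2.+1 ^ (a2.-1 - u2) * q2.+2 ^ u2.
set Q1 := balprod (n1 - _) _; set Q2 := balprod (n2 - _) _.
have Q1E : Q1 = q1 ^ (a1.-1 - u1) * q1.+1 ^ u1 by rewrite /Q1 E1 balprodSE.
have Q2E : Q2 = q2 ^ (a2.-1 - u2) * q2.+1 ^ u2 by rewrite /Q2 E2 balprodSE.
have A1E : turan n1.-1 a1 = q1.+1 * P1.
  rewrite E1 addnS /= turanE ?(ltnW ua1) //.
  by rewrite /P1; case: (a1) ua1 => // a ua; rewrite subSn // expnS mulnA.
have A2E : turan n2.-1 a2 = q2.+1 * P2.
  rewrite E2 addnS /= turanE ?(ltnW ua2) //.
  by rewrite /P2; case: (a2) ua2 => // a ua; rewrite subSn // expnS mulnA.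
have T2E : turan n2 a2 = q2.+2 * P2.
  rewrite E2 turanE //.
  by rewrite /P2; case: (a2) ua2 => // a ua; rewrite subSS expnS mulnCA.
have B2E : balprod n2 a2 = q2.+1 * Q2.
  rewrite E2 balprodE // Q2E.
  by case: (a2) ua2 => // a ua; rewrite subSS expnS mulnCA.
have [PQ1 PQ2] : Q1 <= P1 /\ Q2 <= P2.
  by rewrite Q1E Q2E !leq_mul ?leq_expl.
have P1_gt0 : 0 < P1 by rewrite muln_gt0 !expn_gt0.
have P2_gt0 : 0 < P2 by rewrite muln_gt0 !expn_gt0.
have L : q1.+1 * P1 * (q2.+2 * P2) <= turan (n1 + n2).-1 (a1 + a2).
  by rewrite -A1E -T2E -nn'; apply: turan_superadd.
have M : Q1 * (q2.+1 * Q2) <= balprod (n1 + n2 - k.+1) (a1 + a2).-1.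
  rewrite -B2E -aa; apply: leq_trans (balprod_superadd _ _ _ _) _.
  exact: balprod_le.
rewrite A1E A2E.
have gap : q1.+1 * P1 * (q2.+1 * P2) + Q1 * (q2.+1 * P2) + Q2 * (q1.+1 * P1)
    + (P2 - Q2) * (q1.+1 * P1 - q2.+1 * Q1)
  = q1.+1 * P1 * (q2.+2 * P2) + Q1 * (q2.+1 * Q2).
  have [d dE] : exists d, q1.+1 * P1 = q2.+1 * Q1 + d.
    by exists (q1.+1 * P1 - q2.+1 * Q1); rewrite subnKC // leq_mul.
  have [e eE] : exists e, P2 = Q2 + e by exists (P2 - Q2); rewrite subnKC.
  by rewrite dE eE !addKn; clear; lia.
have squeeze h g x y t b : h + g = x + y -> x <= t -> y <= b ->
  h <= t + b /\ (h = t + b -> x = t /\ g = 0) by clear; lia.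
have [le_hf eq_hf] := squeeze _ _ _ _ _ _ gap L M.
split=> // {squeeze gap M le_hf} /eq_hf[E /eqP].
(* The gap (P2 - Q2)((q1 + 1) P1 - (q2 + 1) Q1) vanishes. The first factor does so only for a2 = 1;
   the second only for a1 = 1, and then q1 = q2. *)
rewrite muln_eq0 !subn_eq0 => /orP[le_PQ|le_kPQ].
  left; have a21 : a2 = 1 by apply: (@expn_gap q2 u2) => //; rewrite -/P2 -Q2E.
  by split=> //; rewrite -E -T2E a21.
have a11 : a1 = 1.
  apply: (@expn_gap q1 u1) => //; rewrite -/P1 -Q1E.
  by rewrite -(@leq_pmul2l q1.+1) //; apply: leq_trans le_kPQ (leq_mul _ _).
have P11 : P1 = 1.
  by have := ua1; rewrite /P1 a11 ltnS leqn0 => /eqP ->.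
have Q11 : Q1 = 1.
  by have := ua1; rewrite Q1E a11 ltnS leqn0 => /eqP ->.
have u10 : u1 = 0 by have := ua1; rewrite a11 ltnS leqn0 => /eqP.
have q12 : q1 = q2.
  by move: le_kPQ; rewrite P11 Q11 !muln1 ltnS => ?; apply/eqP; rewrite eqn_leq q21 andbT.
right; split=> //; rewrite -E P11 -q12 /turan /balprod !divn1 !modn1 expn1 expn0 muln1.
by move: E1; rewrite a11 u10; clear; lia.
Qed.

Lemma bridge_bound n1 a1 n2 a2 :
  0 < a1 <= n1 -> 0 < a2 <= n2 ->
  let A1 := turan n1.-1 a1 in let A2 := turan n2.-1 a2 in
  let h := A1 * A2 + (tconn n1 a1 - A1) * A2 + (tconn n2 a2 - A2) * A1 in
  let f := tconn (n1 + n2) (a1 + a2) in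
  h <= f /\ (h = f ->
   a2 = 1 /\ A1 * turan n2 1 = turan (n1 + n2).-1 (a1 + a2) \/
   a1 = 1 /\ A2 * turan n1 1 = turan (n1 + n2).-1 (a1 + a2)).
Proof.
move=> b1 b2; case: (leqP (n2.-1 %/ a2) (n1.-1 %/ a1)) => [|/ltnW] le_q.
  exact: bridge_bound_sorted.
have [H1 H2] := bridge_bound_sorted b2 b1 le_q.
move=> /=; rewrite [n1 + n2]addnC [a1 + a2]addnC.
rewrite [turan n1.-1 a1 * _]mulnC addnAC; split=> // E.
by have [|] := H2 E; [right | left].
Qed.

(** * Stable sets of induced subgraphs *)

(** Induced subgraphs are represented by vertex sets [U] over one fixed type, so that inductions can
    pass to subsets without changing the type. *)
Definition fib (T : finType) (G : rel T) (U : {set T}) : nat :=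
  #|[set S : {set T} | (S \subset U) && stable G S]|.

Definition alpha (T : finType) (G : rel T) (U : {set T}) : nat :=
  \max_(S : {set T} | (S \subset U) && stable G S) #|S|.

Definition nbrs (T : finType) (G : rel T) (U : {set T}) x := [set y in U | G x y].

Definition far (T : finType) (G : rel T) (U : {set T}) x :=
  [set y in U | (y != x) && ~~ G x y].

Lemma stableP (T : finType) (G : rel T) (S : {set T}) :
  reflect {in S &, forall x y, ~~ G x y} (stable G S).
Proof.
apply: (iffP forall_inP) => [H x y xS|H x xS]; first exact: (forall_inP (H x xS)).
by apply/forall_inP => y; apply: H.
Qed.

Lemma stable_sub (T : finType) (G : rel T) (S S' : {set T}) :
  S' \subset S -> stable G S -> stable G S'.
Proof.
by move=> /subsetP sub /stableP H; apply/stableP => x y /sub xS /sub; apply: H.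
Qed.

Lemma stable0 (T : finType) (G : rel T) : stable G set0.
Proof. by apply/stableP => x y; rewrite inE. Qed.

Lemma stable1 (T : finType) (G : rel T) x : irreflexive G -> stable G [set x].
Proof. by move=> irr; apply/stableP => y z /set1P -> /set1P ->; rewrite irr. Qed.

Lemma stableU1 (T : finType) (G : rel T) x (S : {set T}) :
  symmetric G -> irreflexive G -> {in S, forall y, ~~ G x y} ->
  stable G S -> stable G (x |: S).
Proof.
move=> sym irr xS /stableP stS; apply/stableP => y z.
case/setU1P=> [->|yS] /setU1P[->|zS]; first by rewrite irr.
- exact: xS.
- by rewrite sym xS.
- exact: stS.
Qed.

Lemma leq_alpha (T : finType) (G : rel T) (U S : {set T}) :
  S \subset U -> stable G S -> #|S| <= alpha G U.
Proof. by move=> SU stS; rewrite /alpha (bigmax_sup S) // SU. Qed.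

Lemma alpha_witness (T : finType) (G : rel T) (U : {set T}) :
  exists S : {set T}, [/\ S \subset U, stable G S & #|S| = alpha G U].
Proof.
have : 0 < #|[pred S : {set T} | (S \subset U) && stable G S]|.
  by apply/card_gt0P; exists set0; rewrite inE sub0set stable0.
case/(eq_bigmax_cond (fun S : {set T} => #|S|)) => S /andP[SU stS] E.
by exists S.
Qed.

Lemma alpha_sub (T : finType) (G : rel T) (U V : {set T}) :
  U \subset V -> alpha G U <= alpha G V.
Proof.
move=> UV; have [S [SU stS <-]] := alpha_witness G U.
by apply: leq_alpha => //; apply: subset_trans UV.
Qed.

Lemma alpha_le_card (T : finType) (G : rel T) (U : {set T}) : alpha G U <= #|U|.
Proof. by have [S [SU _ <-]] := alpha_witness G U; apply: subset_leq_card. Qed.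

Lemma alpha_gt0 (T : finType) (G : rel T) (U : {set T}) x :
  irreflexive G -> x \in U -> 0 < alpha G U.
Proof.
move=> irr xU; rewrite -(cards1 x) leq_alpha ?sub1set //.
exact: stable1.
Qed.

Lemma far_sub (T : finType) (G : rel T) (U : {set T}) x : far G U x \subset U :\ x.
Proof. by apply/subsetP => y; rewrite !inE => /and3P[-> ->]. Qed.

Lemma card_far (T : finType) (G : rel T) (U : {set T}) x :
  irreflexive G -> x \in U -> #|U| = (#|nbrs G U x| + #|far G U x|).+1.
Proof.
move=> irr xU; rewrite (cardsD1 x U) xU add1n; congr _.+1.
rewrite -(cardsID [set y | G x y] (U :\ x)); congr addn; apply: eq_card => y; rewrite !inE.
  by rewrite andbC; case: eqP => [->|_] //=; rewrite ?irr ?andbF // andbC.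
by rewrite andbC andbA andbAC andbC; case: (y \in U); case: (y != x); case: (G x y).
Qed.

Lemma alpha_far (T : finType) (G : rel T) (U : {set T}) x :
  symmetric G -> irreflexive G -> x \in U -> alpha G (far G U x) < alpha G U.
Proof.
move=> sym irr xU; have [S [SU stS <-]] := alpha_witness G (far G U x).
have xS : x \notin S by apply: contraTN xU => /(subsetP SU); rewrite !inE eqxx andbF.
rewrite -add1n -(_ : #|x |: S| = 1 + #|S|); last by rewrite cardsU1 xS.
apply: leq_alpha.
  rewrite subUset sub1set xU; apply: subset_trans SU _.
  exact: subset_trans (far_sub _ _ _) (subsetDl _ _).
by apply: stableU1 => // y /(subsetP SU); rewrite !inE => /and3P[].
Qed.

(** Stable sets avoiding x are those of G - x; adding x is a bijection from the stable sets of G -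
    N[x] to those containing x. *)
Lemma fib_rec (T : finType) (G : rel T) (U : {set T}) x :
  symmetric G -> irreflexive G -> x \in U ->
  fib G U = fib G (U :\ x) + fib G (far G U x).
Proof.
move=> sym irr xU; rewrite /fib -(cardsID [set S : {set T} | x \notin S]).
congr addn; first by apply: eq_card => S; rewrite !inE subsetD1; case: (S \subset U);
  case: (x \in S); case: (stable G S).
rewrite -[RHS](card_in_imset (f := fun S => x |: S)) => [|S S']; last first.
  rewrite !inE => /andP[SU _] /andP[S'U _] E.
  have nx (S1 : {set T}) : S1 \subset far G U x -> x \notin S1.
    by move=> H; apply/negP => /(subsetP H); rewrite !inE eqxx andbF.
  by rewrite -(setU1K (nx _ SU)) E setU1K // nx.
apply: eq_card => S; apply/idP/imsetP.
  rewrite !inE negbK => /and3P[xS SU stS]; exists (S :\ x); last by rewrite setD1K.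
  rewrite inE (stable_sub (subsetDl _ _) stS) andbT.
  apply/subsetP => y; rewrite !inE => /andP[-> yS].
  by rewrite (subsetP SU) //=; apply: (stableP _ _ stS).
case=> S'; rewrite !inE => /andP[S'F stS'] ->; rewrite !inE eqxx /= subUset sub1set xU.
rewrite (subset_trans S'F) ?(subset_trans (far_sub _ _ _)) ?subsetDl //=.
by apply: stableU1 => // y /(subsetP S'F); rewrite !inE => /and3P[].
Qed.

Lemma fib_set0 (T : finType) (G : rel T) : fib G set0 = 1.
Proof.
rewrite /fib -(cards1 (set0 : {set T})); apply: eq_card => S; rewrite !inE subset0.
by case: eqP => // ->; rewrite stable0.
Qed.

Lemma fib_gt0 (T : finType) (G : rel T) (U : {set T}) : 0 < fib G U.
Proof. by apply/card_gt0P; exists set0; rewrite inE sub0set stable0. Qed.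

(** Induction on the size of B: applying [fib_rec] at a vertex z of B to both sides leaves A
    untouched. *)
Lemma fib_disjointU (T : finType) (G : rel T) (A B : {set T}) :
  symmetric G -> irreflexive G -> [disjoint A & B] ->
  {in A & B, forall x y, ~~ G x y} -> fib G (A :|: B) = fib G A * fib G B.
Proof.
move=> sym irr; elim: {B}#|B| {-2}B (leqnn #|B|) => [|n IH] B.
  by rewrite leqn0 cards_eq0 => /eqP -> _ _; rewrite setU0 fib_set0 muln1.
case: (set_0Vmem B) => [-> _ _ _|[z zB] Bn dAB nAB].
  by rewrite setU0 fib_set0 muln1.
have zA : z \notin A by rewrite (disjointFl dAB).
have sub (C : {set T}) : C \subset B :\ z -> fib G (A :|: C) = fib G A * fib G C.
  move=> CB; have CB' := subset_trans CB (subsetDl _ _).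
  apply: IH.
  - by rewrite -ltnS (leq_trans _ Bn) // (cardsD1 z B) zB add1n ltnS subset_leq_card.
  - by apply: disjointWr dAB.
  - by move=> x y xA /(subsetP CB'); apply: nAB.
rewrite (@fib_rec _ _ _ z) // ?inE ?zB ?orbT // (@fib_rec _ _ B z) // mulnDr.
rewrite -!sub ?far_sub //; congr (fib G _ + fib G _); apply/setP => y; rewrite !inE.
  by case: eqP => [->|] //=; rewrite (negPf zA).
case yA: (y \in A) => //=; rewrite sym nAB // andbT.
by apply: contraNN zA => /eqP <-.
Qed.

(** * Turan graphs *)

Definition cls (T : finType) (W : {set T}) (c : T -> nat) i := [set z in W | c z == i].

(** A disjoint union of cliques, numbered by [c]. Empty classes are allowed, so [a] may exceed the
    number of cliques. Together with [balanced] this describes the Turan graph with [a] cliques. *)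
Definition colored (T : finType) (G : rel T) (W : {set T}) a (c : T -> nat) :=
  {in W, forall z, c z < a} /\
  {in W &, forall z w, G z w = (z != w) && (c z == c w)}.

Definition balanced (T : finType) (W : {set T}) a (c : T -> nat) :=
  forall i j, i < a -> j < a -> #|cls W c i| <= #|cls W c j|.+1.

Lemma sum_card_cls (T : finType) (W : {set T}) a (c : T -> nat) :
  {in W, forall z, c z < a} -> \sum_(i < a) #|cls W c i| = #|W|.
Proof.
move=> ca; have E i : #|cls W c i| = \sum_(z in W) (c z == i).
  rewrite -sum1_card (eq_bigl (fun z => (z \in W) && (c z == i))) => [|z]; last by rewrite inE.
  by rewrite big_mkcondr; apply: eq_bigr => z _; case: eqP.
under eq_bigr => i _ do rewrite E.
rewrite -sum1_card exchange_big; apply: eq_bigr => z /ca cz.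
rewrite (bigD1 (Ordinal cz)) //= eqxx big1 // => i.
by rewrite -val_eqE /= eq_sym => /negPf ->.
Qed.

Lemma colored_sub (T : finType) (G : rel T) (V W : {set T}) a c :
  V \subset W -> colored G W a c -> colored G V a c.
Proof.
move=> /subsetP VW [ca cE]; split=> [z /VW|z w /VW zW /VW]; first exact: ca.
exact: cE.
Qed.

(** A stable set takes at most one vertex of each clique. In the induction, removing z shortens its
    class by one, while removing N[z] empties it; all other classes persist. *)
Lemma fib_colored (T : finType) (G : rel T) (W : {set T}) a c :
  symmetric G -> irreflexive G -> colored G W a c ->
  fib G W = \prod_(i < a) #|cls W c i|.+1.
Proof.
move=> sym irr; elim: {W}#|W| {-2}W (leqnn #|W|) => [|n IH] W.
  rewrite leqn0 cards_eq0 => /eqP -> _; rewrite fib_set0 big1 // => i _.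
  by congr _.+1; apply: eq_card0 => z; rewrite !inE.
case: (set_0Vmem W) => [-> _ _|[z zW] Wn col].
  rewrite fib_set0 big1 // => i _.
  by congr _.+1; apply: eq_card0 => z; rewrite !inE.
have Wz_n : #|W :\ z| <= n by move: Wn; rewrite (cardsD1 z W) zW.
have [ca cE] := col.
rewrite (fib_rec sym irr zW) !IH ?(leq_trans (subset_leq_card (far_sub _ _ _))) //; first last.
- by apply: colored_sub col; rewrite subsetDl.
- by apply: colored_sub col; rewrite (subset_trans (far_sub _ _ _)) ?subsetDl.
pose i0 := Ordinal (ca z zW).
have D (V : {set T}) : \prod_(i < a) #|cls V c i|.+1 =
    #|cls V c (c z)|.+1 * \prod_(i < a | i != i0) #|cls V c i|.+1.
  by rewrite (bigD1 i0).
rewrite !D.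
have -> : cls (far G W z) c (c z) = set0.
  apply/setP => w; rewrite !inE; case wW: (w \in W) => //=.
  by rewrite cE // eq_sym; case: eqP => //= _; rewrite eq_sym andNb.
have -> : cls (W :\ z) c (c z) = cls W c (c z) :\ z.
  by apply/setP => w; rewrite !inE andbA.
rewrite [#|cls W c (c z)|](cardsD1 z) !inE zW eqxx /= cards0 mul1n [X in X * _]/= add1n.
set s := #|_|.
have E (V : {set T}) : (forall w, c w != c z -> (w \in V) = (w \in W)) ->
    \prod_(i < a | i != i0) #|cls V c i|.+1 = \prod_(i < a | i != i0) #|cls W c i|.+1.
  move=> VW; apply: eq_bigr => i ii0; congr _.+1; apply: eq_card => w; rewrite !inE.
  case: eqP => [cw|_]; last by rewrite !andbF.
  by rewrite !andbT VW // cw; exact: ii0.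
rewrite !E ?mulSn 1?addnC // => w; rewrite !inE eq_sym => cw.
  case wW: (w \in W) => //=; rewrite cE // (negPf cw) andbF andbT.
  by apply: contraNneq cw => ->.
by case: eqP => // wz; rewrite wz eqxx in cw.
Qed.

(** Otherwise x has a non-neighbour in every class; one from each class together with x would be a
    stable set of size a + 1. *)
Lemma full_class (T : finType) (G : rel T) (W : {set T}) a c x :
  symmetric G -> irreflexive G -> colored G W a c -> x \notin W ->
  alpha G (x |: W) <= a ->
  exists2 i0, i0 < a & {in W, forall z, c z = i0 -> G x z}.
Proof.
move=> sym irr [ca cE] xW le_a.
case: (boolP [exists i0 : 'I_a, [forall z in W, (c z == i0) ==> G x z]]).
  case/existsP=> i0 /forall_inP H; exists i0 => // z zW /eqP cz.
  by have := H z zW; rewrite cz.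
rewrite negb_exists => /forallP H.
have /fin_all_exists[f fP] : forall i : 'I_a, exists z, [/\ z \in W, c z = i & ~~ G x z].
  move=> i; have := H i; rewrite negb_forall_in => /exists_inP[z zW].
  by rewrite negb_imply => /andP[/eqP cz nG]; exists z.
have f_inj : injective f.
  by move=> i j E; apply: val_inj; have [_ ci _] := fP i; have [_ cj _] := fP j;
    rewrite -[LHS]ci -[RHS]cj E.
suff : a.+1 <= a by rewrite ltnn.
apply: leq_trans le_a.
have -> : a.+1 = #|x |: f @: setT|.
  rewrite cardsU1 card_imset // cardsT card_ord.
  case: imsetP => // -[i _ E]; have [fW _ _] := fP i.
  by rewrite E fW in xW.
apply: leq_alpha.
  by apply/setUS/subsetP => _ /imsetP[i _ ->]; have [] := fP i.
apply: stableU1 => // [_ /imsetP[i _ ->]|]; first by have [] := fP i.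
apply/stableP => _ _ /imsetP[i _ ->] /imsetP[j _ ->].
have [fi ci _] := fP i; have [fj cj _] := fP j; rewrite cE // ci cj.
by apply/negP => /andP[nE /eqP/val_inj E]; rewrite E eqxx in nE.
Qed.

(** The greedy argument: repeatedly pick a vertex of degree at most m in what remains and discard
    its closed neighbourhood, losing at most m + 1 vertices each time. *)
Lemma alpha_degenerate (T : finType) (G : rel T) (U : {set T}) m :
  symmetric G -> irreflexive G ->
  (forall V : {set T}, V \subset U -> V != set0 ->
     exists2 x, x \in V & #|nbrs G V x| <= m) ->
  #|U| <= alpha G U * m.+1.
Proof.
move=> sym irr; elim: {U}#|U| {-2}U (leqnn #|U|) => [|n IH] U.
  by rewrite leqn0 => /eqP ->.
case: (eqVneq U set0) => [->|U0 Un H]; first by rewrite cards0.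
have [x xU dx] := H U (subxx _) U0.
have FU : far G U x \subset U := subset_trans (far_sub _ _ _) (subsetDl _ _).
have := IH (far G U x); rewrite (card_far irr xU) in Un *.
move=> IHF; have {}IHF : #|far G U x| <= alpha G (far G U x) * m.+1.
  apply: IHF => [|V VF]; first lia.
  by apply: H; apply: subset_trans FU.
have := alpha_far sym irr xU; nia.
Qed.

Lemma max_degree (T : finType) (G : rel T) (U : {set T}) x0 : x0 \in U ->
  exists2 x, x \in U & {in U, forall y, #|nbrs G U y| <= #|nbrs G U x|}.
Proof.
move=> x0U; case: (arg_maxnP (fun x => #|nbrs G U x|) x0U) => x xU H.
by exists x.
Qed.

Lemma nbrs_sub (T : finType) (G : rel T) (V U : {set T}) x :
  V \subset U -> #|nbrs G V x| <= #|nbrs G U x|.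
Proof.
move=> /subsetP VU; apply/subset_leq_card/subsetP => y.
by rewrite !inE => /andP[/VU ->].
Qed.

Lemma balanced_ge (T : finType) (W : {set T}) a (c : T -> nat) i :
  {in W, forall z, c z < a} -> balanced W a c -> i < a ->
  #|W| %/ a <= #|cls W c i|.
Proof.
move=> ca bal ia; rewrite leqNgt; apply/negP; have := leq_divM #|W| a.
move: (#|W| %/ a) => q qa lt_q.
have := sum_card_cls ca; rewrite (bigD1 (Ordinal ia)) //=.
have : \sum_(j < a | j != Ordinal ia) #|cls W c j| <= a.-1 * q.
  have -> : a.-1 = #|[pred j : 'I_a | j != Ordinal ia]|.
    by rewrite cardC1 card_ord.
  by rewrite -sum_nat_const; apply: leq_sum => j _; apply: leq_trans (bal j i _ _) lt_q.
have : a.-1 * q + q = q * a.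
  by rewrite -mulSnr prednK ?(leq_ltn_trans _ ia) // mulnC.
move: (\sum_(j < a | _) _) (a.-1 * q) (q * a) qa lt_q; lia.
Qed.

(** The greedy bound forces maximum degree at least [#|U|.-1 %/ a], so both terms of the recursion
    at such a vertex are dominated by those of [turan_rec]. Equality is inherited by G - x, which is
    then a Turan graph, and x has to complete one of its classes. *)
Theorem fib_le_turan (T : finType) (G : rel T) (U : {set T}) a :
  symmetric G -> irreflexive G -> alpha G U <= a ->
  fib G U <= turan #|U| a /\
  (fib G U = turan #|U| a -> exists2 c, colored G U a c & balanced U a c).
Proof.
move=> sym irr; elim: {U}#|U| {-2}U (leqnn #|U|) a => [|n IH] U.
  rewrite leqn0 cards_eq0 => /eqP -> a _; rewrite fib_set0 cards0.
  split.
    rewrite /turan add0n /balprod; case: a => [|a]; first by [].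
    by rewrite divnn modnn /= exp1n.
  move=> _; exists (fun=> 0); first by split=> [z|z w]; rewrite inE.
  by move=> i j _ _; rewrite (eq_card0 (A := cls _ _ _)) // => z; rewrite !inE.
move=> Un a; case: (set_0Vmem U) => [->|[x0 x0U] le_a].
  by move=> _; apply: IH; rewrite ?cards0 //; apply: leq_trans (alpha_le_card _ _) _;
    rewrite cards0.
have a_gt0 : 0 < a := leq_trans (alpha_gt0 irr x0U) le_a.
have [x xU max_x] := max_degree G x0U.
have U_gt0 : 0 < #|U| by apply/card_gt0P; exists x.
have Uxn : #|U :\ x|.+1 = #|U| by rewrite (cardsD1 x U) xU.
have Ux_n : #|U :\ x| <= n by rewrite -ltnS Uxn.
have D_ge : #|U| <= a * #|nbrs G U x|.+1.
  apply: leq_trans (alpha_degenerate sym irr _) (leq_mul le_a (leqnn _)) => V VU /set0Pn[v vV].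
  exists v => //; apply: leq_trans (nbrs_sub _ _ VU) _.
  exact/max_x/(subsetP VU).
have cardF := card_far irr xU.
have D_k : #|U|.-1 %/ a <= #|nbrs G U x|.
  rewrite -ltnS ltn_divLR //; lia.
have [IH1 IH1eq] : _ := IH (U :\ x) Ux_n a (leq_trans (alpha_sub _ (subsetDl _ _)) le_a).
have aF : alpha G (far G U x) <= a.-1.
  by rewrite -ltnS prednK // (leq_trans (alpha_far sym irr xU) le_a).
have [IH2 _] : _ := IH (far G U x) (leq_trans (subset_leq_card (far_sub _ _ _)) Ux_n) _ aF.
set q := #|U|.-1 %/ a in D_k *; set d := #|nbrs G U x| in D_k cardF *.
have far_q : #|far G U x| <= #|U| - q.+1 by move: cardF D_k; clear; lia.
have Uxp : #|U :\ x| = #|U|.-1 by rewrite -Uxn.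
rewrite Uxp in IH1 IH1eq.
have le_F := leq_trans IH2 (turan_le a.-1 far_q).
rewrite (fib_rec sym irr xU) (turan_rec U_gt0 a_gt0) -/q.
split; first exact: leq_add.
move=> E; have [E1 E2] : fib G (U :\ x) = turan #|U|.-1 a /\
    fib G (far G U x) = turan (#|U| - q.+1) a.-1.
  by move: E IH1 le_F; clear; lia.
have dq : d = q.
  apply/eqP; rewrite eqn_leq D_k andbT leqNgt; apply/negP => lt_qd.
  (* Strict monotonicity of [turan] needs a - 1 > 0; for a = 1 the quotient q is already the largest
     possible degree. *)
  case: (ltnP 1 a) => [a_gt1|a_le1].
    suff : fib G (far G U x) < turan (#|U| - q.+1) a.-1 by rewrite E2 ltnn.
    apply: leq_ltn_trans IH2 (turan_lt _ _); first by move: cardF lt_qd; clear; lia.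
    by rewrite -ltnS prednK.
  have a1 : a = 1 by apply/eqP; rewrite eqn_leq a_le1.
  by move: lt_qd cardF; rewrite /q a1 divn1; clear; lia.
have [c col bal] := IH1eq E1.
have xUx : x \notin U :\ x by rewrite !inE eqxx.
have [|i0 i0a full] := full_class sym irr col xUx; first by rewrite setD1K.
have s_ge := balanced_ge col.1 bal; rewrite Uxp -/q in s_ge.
have clsN : cls (U :\ x) c i0 \subset nbrs G U x.
  apply/subsetP => z; rewrite !inE -andbA => /and3P[zx zU /eqP cz].
  by rewrite zU full // !inE zx.
(* The class inside the neighbourhood has at least q vertices and x has exactly q neighbours, so the
   two sets coincide and x can join the class. *)
have {}clsN : cls (U :\ x) c i0 = nbrs G U x.
  by apply/eqP; rewrite eqEcard clsN -/d dq s_ge.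
pose c' z := if z == x then i0 else c z.
have cls0 : cls U c' i0 = x |: cls (U :\ x) c i0.
  by apply/setP => z; rewrite !inE /c'; case: (eqVneq z x) => [->|_] //=; rewrite xU eqxx.
have clsE j : j != i0 -> cls U c' j = cls (U :\ x) c j.
  move=> ji0; apply/setP => z; rewrite !inE /c'; have [->|_] := eqVneq z x => //=.
  by rewrite eq_sym (negPf ji0) andbF.
have s_i0 : #|cls U c' i0| = q.+1.
  by rewrite cls0 cardsU1 clsN -/d dq inE irr andbF.
have s_le j : j < a -> #|cls U c' j| <= q.+1.
  move=> ja; have [->|ji0] := eqVneq j i0; first by rewrite s_i0.
  by rewrite clsE // (leq_trans (bal j i0 ja i0a)) // clsN -/d dq.
have s_ge' j : j < a -> q <= #|cls U c' j|.
  move=> ja; have [->|ji0] := eqVneq j i0; first by rewrite s_i0.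
  by rewrite clsE // s_ge.
exists c'; last by move=> i j ia ja; apply: leq_trans (s_le i ia) _; rewrite ltnS s_ge'.
have [ca cE] := col.
have Gx w : w \in U -> w != x -> G x w = (c w == i0).
  move=> wU wx; have /setP/(_ w) := clsN; rewrite !inE wx wU.
  by move=> /= ->.
split=> [z zU|z w zU wU]; rewrite /c'.
  by have [//|zx] := eqVneq z x; rewrite ca // !inE zx.
have [->|zx] := eqVneq z x; have [->|wx] := eqVneq w x.
- by rewrite irr eqxx.
- by rewrite Gx // eq_sym wx eq_sym.
- by rewrite sym Gx // zx.
- by rewrite cE // !inE ?zx ?wx.
Qed.

(** * Turan-connected graphs *)

(** Connectedness in terms of cuts, which restricts well to vertex subsets and serves directly in
    the bridge and cut-vertex arguments. *)
Definition cut_connected (T : finType) (G : rel T) (U : {set T}) :=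
  forall A : {set T}, A \subset U -> A != set0 -> A != U ->
  exists x y, [/\ x \in A, y \in U :\: A & G x y].

(** Describes TC_{|U|,a} with hub x: [c] numbers the cliques of G - x, and x belongs with class
    [i0], which has the smaller order because the hub itself is missing from it. *)
Definition tc_shape (T : finType) (G : rel T) (U : {set T}) x a c i0 :=
  [/\ colored G (U :\ x) a c,
      i0 < a /\ {in U :\ x, forall z, c z = i0 -> G x z},
      #|cls (U :\ x) c i0| = #|U|.-1 %/ a,
      forall j, j < a -> j != i0 -> #|nbrs G (cls (U :\ x) c j) x| = 1 &
      forall j, j < a ->
        #|U|.-1 %/ a <= #|cls (U :\ x) c j| <= (#|U|.-1 %/ a).+1].

Lemma prod_le_balprod_but1 a (s : 'I_a -> nat) (i : 'I_a) :
  \prod_(j < a | j != i) s j <= balprod (\sum_(j < a | j != i) s j) a.-1.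
Proof.
have := prod_le_balprod [seq s j | j in [pred j | j != i]].
rewrite size_map -cardE cardC1 card_ord sumnE !big_map !big_enum /=.
by congr (_ <= balprod _ _); apply: eq_bigl.
Qed.

Lemma ltn_prod_at (I : finType) (P : pred I) (F F' : I -> nat) i :
  P i -> F i < F' i -> (forall j, P j -> F j <= F' j) ->
  (forall j, P j -> 0 < F' j) ->
  \prod_(j | P j) F j < \prod_(j | P j) F' j.
Proof.
move=> Pi lt_i le_F F'_gt0; rewrite !(bigD1 (P := P) i) //=.
have R_gt0 : 0 < \prod_(j | P j && (j != i)) F' j.
  by rewrite prodn_cond_gt0 // => j /andP[/F'_gt0].
have le_R : \prod_(j | P j && (j != i)) F j <= \prod_(j | P j && (j != i)) F' j.
  by apply: leq_prod => j /andP[/le_F].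
by apply: leq_ltn_trans (leq_mul (leqnn _) le_R) _; rewrite ltn_pmul2r.
Qed.

Lemma cut_connected_alpha_lt (T : finType) (G : rel T) (U : {set T}) :
  cut_connected G U -> 1 < #|U| -> alpha G U < #|U|.
Proof.
move=> conn U_gt1; have [S [SU stS SE]] := alpha_witness G U.
rewrite ltn_neqAle alpha_le_card andbT -SE; apply: contraTneq stS => cardS.
have {SU cardS SE} -> : S = U by apply/eqP; rewrite eqEcard SU cardS /=.
have [x xU] : exists x, x \in U by apply/card_gt0P; lia.
have xsU : [set x] \subset U by rewrite sub1set.
have [||y [z [yx zU Gyz]]] := conn _ xsU.
- by apply/set0Pn; exists x; rewrite inE.
- by apply: contraTneq U_gt1 => <-; rewrite cards1.
apply/stableP => /(_ x z xU); rewrite (set1P yx) in Gyz.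
by rewrite Gyz; move: zU; rewrite !inE => /andP[_ zU] /(_ zU).
Qed.

(** G - x is a Turan graph by the equality case, and x is complete to a class i0. Let s_j be the
    class orders and d_j >= 1 the numbers of neighbours of x in them. Then F(G - N[x]) is the
    product of s_j - d_j + 1 over j other than i0, at most the product of the s_j. To reach the hub
    term of [tconn], class i0 must have the least possible order and all these d_j must be 1. *)
Lemma tc_structure (T : finType) (G : rel T) (U : {set T}) x :
  symmetric G -> irreflexive G -> cut_connected G U -> x \in U ->
  alpha G U < #|U| ->
  fib G U = tconn #|U| (alpha G U) ->
  fib G (U :\ x) = turan #|U|.-1 (alpha G U) ->
  exists c i0, tc_shape G U x (alpha G U) c i0.
Proof.
move=> sym irr conn xU; have := alpha_gt0 irr xU.
have [a aE] : exists a, a = alpha G U by exists (alpha G U).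
have le_a : alpha G U <= a by rewrite aE.
rewrite -aE => a_gt0 a_U EU EUx.
have Uxp : #|U :\ x| = #|U|.-1 by rewrite (cardsD1 x U) xU.
have [|_ Teq] := @fib_le_turan _ G (U :\ x) a sym irr.
  by apply: leq_trans le_a; apply/alpha_sub/subsetDl.
rewrite Uxp in Teq; have [c col bal] := Teq EUx.
have xUx : x \notin U :\ x by rewrite !inE eqxx.
have [|i0 i0a full] := full_class sym irr col xUx; first by rewrite setD1K.
have s_ge := balanced_ge col.1 bal; rewrite Uxp in s_ge.
set q := #|U|.-1 %/ a in s_ge *.
have q_gt0 : 0 < q by rewrite divn_gt0 // -ltnS (ltn_predK a_U).
have [ca cE] := col.
pose s j := #|cls (U :\ x) c j|; pose d j := #|nbrs G (cls (U :\ x) c j) x|.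
(* A class has no edges to the other classes, so the edge leaving it must end in x. *)
have d_gt0 j : j < a -> 0 < d j.
  move=> ja; pose A := cls (U :\ x) c j.
  have AU : A \subset U by apply/subsetP => z; rewrite !inE -andbA => /and3P[].
  have xA : x \notin A by rewrite !inE eqxx.
  have [||z [y [zA yA Gzy]]] := conn A AU.
  - by rewrite -card_gt0 (leq_trans q_gt0) // s_ge.
  - by apply: contraNneq xA => ->.
  suff yx : y = x by apply/card_gt0P; exists z; rewrite inE zA sym -yx.
  apply/eqP; apply: contraLR Gzy => yx; move: zA yA.
  rewrite !inE => /andP[/andP[zx zU] /eqP cz]; rewrite yx /= => /andP[yj yU].
  rewrite yU /= in yj.
  by rewrite cE ?inE ?zx ?yx // cz [j == _]eq_sym (negPf yj) andbF.
have colF := colored_sub (far_sub G U x) col.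
have sF (j : nat) : #|cls (far G U x) c j| + d j = s j.
  rewrite /s -(cardsID [set y | ~~ G x y] (cls (U :\ x) c j)); congr addn; apply: eq_card => z;
    rewrite !inE.
    by case: (z \in U); case: (z != x); case: (c z == j); case: (G x z).
  by rewrite negbK andbC; case: (G x z); rewrite ?andbF ?andbT.
have sF0 : #|cls (far G U x) c i0| = 0.
  apply: eq_card0 => z; rewrite !inE; have [cz|_] := eqVneq (c z) i0; last by rewrite andbF.
  case zU: (z \in U) => //=; case zx: (z != x) => //=.
  by rewrite full // !inE zx.
pose I0 := Ordinal i0a.
have fibF : fib G (far G U x) = balprod (#|U| - q.+1) a.-1.
  move: EU; rewrite (fib_rec sym irr xU) EUx /tconn -/q.
  exact: addnI.
rewrite (fib_colored sym irr colF) (bigD1 I0) //= sF0 mul1n in fibF.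
have prod_s := prod_le_balprod_but1 (fun j : 'I_a => s j) I0.
have sum_s : s i0 + \sum_(j < a | j != I0) s j = #|U|.-1.
  by rewrite -Uxp -(sum_card_cls ca) [RHS](bigD1 I0).
have le_s : \prod_(j < a | j != I0) #|cls (far G U x) c j|.+1 <= \prod_(j < a | j != I0) s j.
  apply: leq_prod => j _; move: (d_gt0 j (ltn_ord j)) (sF j).
  by rewrite -/(d j) -/(s j); move: (d j) (s j); clear; lia.
have s0 : s i0 = q.
  apply/eqP; rewrite eqn_leq s_ge // andbT leqNgt; apply/negP => lt_q.
  case: (ltnP 1 a) => [a_gt1|a_le1]; last first.
    have a1 : a = 1 by apply/eqP; rewrite eqn_leq a_le1.
    have qU : q = #|U|.-1 by rewrite /q a1 divn1.
    by move: lt_q sum_s; rewrite qU; clear; lia.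
  have le_s2 : \sum_(j < a | j != I0) s j <= #|U|.-1 - q.+1.
    by move: sum_s lt_q; clear; lia.
  have := leq_trans le_s (leq_trans prod_s (balprod_le _ le_s2)).
  rewrite fibF leqNgt balprod_lt //; have := leq_divM #|U|.-1 a; rewrite -/q => qa.
    by move: a_gt1 qa q_gt0 a_U; clear; nia.
  by move: a_gt1 qa q_gt0 a_U; clear; nia.
exists c, i0; split=> //.
  move=> j ja ji0; apply/eqP; rewrite eqn_leq [0 < _]d_gt0 // andbT leqNgt.
  apply/negP => d_gt1.
  suff : balprod (#|U| - q.+1) a.-1 < \prod_(j < a | j != I0) s j.
    rewrite ltnNge => /negP; apply; apply: leq_trans prod_s _.
    by apply: balprod_le; move: sum_s; rewrite s0; clear; lia.
  rewrite -fibF; apply: (ltn_prod_at (i := Ordinal ja)) => //.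
  - by move: (sF j) d_gt1; rewrite -/(d j) /=; move: (d j) (s j); clear; lia.
  - by move=> k _; move: (d_gt0 k (ltn_ord k)) (sF k); move: (d k) (s k); clear; lia.
  - by move=> k _; apply: leq_trans (s_ge _ _).
move=> j ja; rewrite s_ge //=; apply: leq_trans (bal j i0 ja i0a) _.
by rewrite -/(s i0) s0.
Qed.

(** * Bridges *)

Lemma balprod_gt0 m b : b <= m -> 0 < balprod m b.
Proof.
case: b => [|b] bm; first by rewrite balprodn0.
by rewrite /balprod muln_gt0 !expn_gt0 divn_gt0 // bm.
Qed.

Lemma tconn_gt n a : 0 < a <= n -> turan n.-1 a < tconn n a.
Proof.
case/andP=> a_gt0 an; rewrite /tconn -[ltnLHS]addn0 ltn_add2l balprod_gt0 //.
have [u ua] := posn_decomp (leq_trans a_gt0 an) a_gt0.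
by move: (_ %/ _) => q; move: a_gt0 an ua; clear; nia.
Qed.

Lemma tconn1 n : 0 < n -> tconn n 1 = turan n 1.
Proof. by move=> n_gt0; rewrite turan_rec // /tconn /turan !balprodn0. Qed.

(** Y_i stands for F(G_i - x_i) and Z_i for F(G_i - N[x_i]). Only Y_i and Y_i + Z_i are bounded, so
    Z_i may exceed Q_i; in terms of the slacks e_i and g_i, h - L is nonetheless a sum of
    nonnegative products. *)
Lemma hub_product_bound Y1 Z1 Y2 Z2 A1 Q1 A2 Q2 :
  0 < Y1 -> 0 < Y2 -> 0 < Q1 -> 0 < Q2 -> Y1 <= A1 -> Y2 <= A2 ->
  Y1 + Z1 <= A1 + Q1 -> Y2 + Z2 <= A2 + Q2 ->
  let L := Y1 * (Y2 + Z2) + Z1 * Y2 in let h := A1 * A2 + Q1 * A2 + Q2 * A1 in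
  L <= h /\ (L = h -> [/\ Y1 = A1, Z1 = Q1, Y2 = A2 & Z2 = Q2]).
Proof.
move=> Y1p Y2p Q1p Q2p /subnKC; move: (A1 - Y1) => e1 <- /subnKC.
move: (A2 - Y2) => e2 <-; rewrite -!addnA !leq_add2l => /subnKC.
move: (e1 + Q1 - Z1) => g1 E1 /subnKC; move: (e2 + Q2 - Z2) => g2 E2 /=.
have -> : (Y1 + e1) * (Y2 + e2) + (Q1 * (Y2 + e2) + Q2 * (Y1 + e1))
  = Y1 * (Y2 + Z2) + Z1 * Y2 + (Y1 * g2 + Y2 * g1 + e1 * e2 + Q1 * e2 + Q2 * e1).
  have : Y1 * (e2 + Q2) = Y1 * (Z2 + g2) by rewrite E2.
  have : Y2 * (e1 + Q1) = Y2 * (Z1 + g1) by rewrite E1.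
  by clear; lia.
rewrite leq_addr; split=> // /eqP; rewrite -[eqbLHS]addn0 eqn_add2l eq_sym !addn_eq0.
rewrite !muln_eq0 => /andP[/andP[/andP[/andP[G2 G1] _] H2] H1].
by split; lia.
Qed.

Definition fib_bounded (T : finType) (G : rel T) (U : {set T}) :=
  fib G U <= tconn #|U| (alpha G U).

Definition has_hub (T : finType) (G : rel T) (U : {set T}) :=
  exists2 x, x \in U & fib G (U :\ x) = turan #|U|.-1 (alpha G U).

Definition is_C5 (T : finType) (G : rel T) (U : {set T}) :=
  [/\ #|U| = 5, alpha G U = 2 & exists f : T -> 'I_5,
    {in U &, injective f} /\
    {in U &, forall x y, cycle_graph 5 (f x) (f y) = G x y}].

(** An edge leaving a subset of A that misses x cannot be the bridge, so it stays in A. A subset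
    containing x is treated through its complement in A. *)
Lemma cut_connected_side (T : finType) (G : rel T) (A B : {set T}) x y :
  symmetric G -> [disjoint A & B] -> x \in A ->
  {in A & B, forall u v, G u v -> u = x /\ v = y} ->
  cut_connected G (A :|: B) -> cut_connected G A.
Proof.
move=> sym dAB xA bridge conn.
have aux (C : {set T}) : C \subset A -> C != set0 -> x \notin C ->
    exists u v, [/\ u \in C, v \in A :\: C & G u v].
  move=> CA C0 xC; have CU : C \subset A :|: B := subset_trans CA (subsetUl _ _).
  have [||u [v [uC vU Guv]]] := conn C CU => //.
    by apply: contraNneq xC => ->; rewrite inE xA.
  exists u, v; split=> //; move: vU; rewrite !inE => /andP[-> /orP[//|vB]] /=.
  have [ux _] := bridge u v (subsetP CA _ uC) vB Guv.
  by rewrite -ux uC in xC.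
move=> C CA C0 CnA; case: (boolP (x \in C)) => xC; last exact: aux.
have [||u [v [uD vD Guv]]] := aux (A :\: C) (subsetDl _ _).
- by apply: contraNneq CnA => /eqP; rewrite setD_eq0 => AC; rewrite eqEsubset CA.
- by rewrite inE xC.
exists v, u; rewrite uD sym; split=> //; move: vD.
by rewrite setDDr setDv set0U (setIidPr CA).
Qed.

(** Both [fx] and [ffar] factor over the two sides, which brings the count into the form of
    [hub_product_bound]. In the equality case of [bridge_bound] one side has stability number 1, and
    the end of the bridge on the other side is the hub. *)
Lemma bridge_case (T : finType) (G : rel T) (A B : {set T}) x y :
  symmetric G -> irreflexive G -> [disjoint A & B] -> x \in A -> y \in B -> G x y ->
  {in A & B, forall u v, G u v -> u = x /\ v = y} ->
  alpha G (A :|: B) = alpha G A + alpha G B ->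
  fib_bounded G A -> fib_bounded G B ->
  fib_bounded G (A :|: B) /\
  (fib G (A :|: B) = tconn #|A :|: B| (alpha G (A :|: B)) -> has_hub G (A :|: B)).
Proof.
move=> sym irr dAB xA yB Gxy bridge alphaU boundA boundB.
have xB : x \notin B by rewrite (disjointFr dAB).
have yA : y \notin A by rewrite (disjointFl dAB).
have dsub (A' B' : {set T}) : A' \subset A -> B' \subset B -> [disjoint A' & B'].
  by move=> A'A B'B; apply: disjointWl A'A (disjointWr B'B dAB).
have fx : fib G ((A :|: B) :\ x) = fib G (A :\ x) * fib G B.
  rewrite -fib_disjointU ?dsub ?subsetDl // => [|u v uA vB].
    congr fib; apply/setP => z; rewrite !inE; case: eqP => [->|] //=.
    by rewrite (negPf xB).
  move: uA; rewrite !inE => /andP[ux uA]; apply: contraNN ux => Guv.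
  by have [-> _] := bridge u v uA vB Guv.
have fy : fib G ((A :|: B) :\ y) = fib G A * fib G (B :\ y).
  rewrite -fib_disjointU ?dsub ?subsetDl // => [|u v uA].
    congr fib; apply/setP => z; rewrite !inE; case: eqP => [->|] //=.
    by rewrite (negPf yA).
  rewrite !inE => /andP[vy vB]; apply: contraNN vy => Guv.
  by have [_ ->] := bridge u v uA vB Guv.
have ffar : fib G (far G (A :|: B) x) = fib G (far G A x) * fib G (B :\ y).
  have FA : far G A x \subset A := subset_trans (far_sub _ _ _) (subsetDl _ _).
  rewrite -fib_disjointU ?dsub ?subsetDl // => [|u v uA].
    congr fib; apply/setP => z; rewrite !inE; case zA: (z \in A) => /=.
      by rewrite (disjointFr dAB) // andbF orbF.
    case zB: (z \in B); rewrite ?andbF //= andbT.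
    have -> : z != x by apply: contraNneq xB => <-.
    apply/idP/idP; first by apply: contraNneq => ->.
    by apply: contraNN => /(bridge x z xA zB)[_ ->].
  rewrite !inE => /andP[vy vB]; apply: contraNN vy => Guv.
  by have [_ ->] := bridge u v (subsetP FA _ uA) vB Guv.
have xU : x \in A :|: B by rewrite inE xA.
have yU : y \in A :|: B by rewrite inE yB orbT.
have cU : #|A :|: B| = #|A| + #|B| by rewrite cardsU disjoint_setI0 // cards0 subn0.
have aA : 0 < alpha G A <= #|A| by rewrite (alpha_gt0 irr xA) alpha_le_card.
have aB : 0 < alpha G B <= #|B| by rewrite (alpha_gt0 irr yB) alpha_le_card.
have [YA _] := fib_le_turan sym irr (alpha_sub G (subsetDl A [set x])).
have [YB _] := fib_le_turan sym irr (alpha_sub G (subsetDl B [set y])).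
have cA : #|A :\ x| = #|A|.-1 by rewrite (cardsD1 x A) xA.
have cB : #|B :\ y| = #|B|.-1 by rewrite (cardsD1 y B) yB.
rewrite cA in YA; rewrite cB in YB.
have fA := fib_rec sym irr xA; have fB := fib_rec sym irr yB.
have [tA tB] := (tconn_gt aA, tconn_gt aB).
have := @hub_product_bound (fib G (A :\ x)) (fib G (far G A x))
  (fib G (B :\ y)) (fib G (far G B y))
  (turan #|A|.-1 (alpha G A)) (tconn #|A| (alpha G A) - turan #|A|.-1 (alpha G A))
  (turan #|B|.-1 (alpha G B)) (tconn #|B| (alpha G B) - turan #|B|.-1 (alpha G B)).
rewrite !fib_gt0 !subn_gt0 tA tB !subnKC ?(ltnW tA) ?(ltnW tB) // -fA -fB.
case=> // le1 eq1; have [le2 eq2] := bridge_bound aA aB.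
have fU : fib G (A :|: B) = fib G (A :\ x) * fib G B + fib G (far G A x) * fib G (B :\ y).
  by rewrite (fib_rec sym irr xU) fx ffar.
rewrite /fib_bounded /has_hub fU cU alphaU; split; first exact: leq_trans le1 le2.
move=> E.
have [|H1 H2 H3 H4] := eq1.
  by apply/eqP; rewrite eqn_leq le1 E le2.
have FA : fib G A = tconn #|A| (alpha G A) by rewrite fA H1 H2 subnKC // ltnW.
have FB : fib G B = tconn #|B| (alpha G B) by rewrite fB H3 H4 subnKC // ltnW.
have [|[a1 T1]|[a1 T1]] := eq2; first by apply/eqP; rewrite eqn_leq le2 -E le1.
- exists x => //; rewrite fx H1 FB -T1 a1 tconn1 //.
  by apply: leq_trans (proj2 (andP aB)); case/andP: aB.
- exists y => //; rewrite fy H3 FA -T1 a1 tconn1 1?mulnC //.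
  by apply: leq_trans (proj2 (andP aA)); case/andP: aA.
Qed.

(** * Alpha-critical graphs *)

Definition del_edge (T : finType) (G : rel T) (x y : T) : rel T :=
  fun u v => G u v && ~~ ((u == x) && (v == y) || (u == y) && (v == x)).

Definition alpha_critical (T : finType) (G : rel T) (U : {set T}) :=
  {in U &, forall x y, G x y -> alpha G U < alpha (del_edge G x y) U}.

(** A stable set of G - xy larger than alpha cannot be stable in G, so it contains x and y, and xy
    is its only edge. *)
Lemma alpha_criticalP (T : finType) (G : rel T) (U : {set T}) x y :
  alpha_critical G U -> x \in U -> y \in U -> G x y ->
  exists S : {set T}, [/\ S \subset U, x \in S, y \in S, alpha G U < #|S| &
    {in S &, forall u v, G u v -> (u = x /\ v = y) \/ (u = y /\ v = x)}].
Proof.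
move=> crit xU yU Gxy; have := crit x y xU yU Gxy.
have [S [SU /stableP stS <-]] := alpha_witness (del_edge G x y) U => lt_S.
have H : {in S &, forall u v, G u v -> (u = x /\ v = y) \/ (u = y /\ v = x)}.
  move=> u v uS vS Guv; have := stS u v uS vS; rewrite /del_edge Guv /= negbK.
  by case/orP=> /andP[/eqP -> /eqP ->]; [left | right].
have xyS : (x \in S) && (y \in S).
  apply: contraTT lt_S => nxy; rewrite -leqNgt; apply: leq_alpha => //.
  apply/stableP => u v uS vS; apply: contraNN nxy => Guv.
  by have [[<- <-]|[<- <-]] := H u v uS vS Guv; rewrite uS vS.
by case/andP: xyS => xS yS; exists S.
Qed.

Lemma alpha_critical_del (T : finType) (G : rel T) (U : {set T}) x y :
  alpha_critical G U -> x \in U -> y \in U -> G x y ->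
  alpha G (U :\ x) = alpha G U.
Proof.
move=> crit xU yU Gxy; apply/eqP; rewrite eqn_leq alpha_sub ?subsetDl //=.
have [S [SU xS yS lt_S H]] := alpha_criticalP crit xU yU Gxy.
rewrite -ltnS (leq_trans lt_S) // (cardsD1 x S) xS ltnS.
apply: leq_alpha; first exact: setSD.
apply/stableP => u v /setD1P[ux uS] /setD1P[vx vS]; apply/negP => Guv.
have [[E _]|[_ E]] := H u v uS vS Guv; first by rewrite E eqxx in ux.
by rewrite E eqxx in vx.
Qed.

(* If x separated A from B, exchanging the A-parts of witnesses for critical edges
   xy (y in A) and xz (z in B) would yield two stable sets of total size 2 alpha + 1. *)
Lemma alpha_critical_no_cut (T : finType) (G : rel T) (U : {set T}) x :
  symmetric G -> irreflexive G -> cut_connected G U -> alpha_critical G U ->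
  x \in U -> cut_connected G (U :\ x).
Proof.
move=> sym irr conn crit xU A AU A0 AnU.
have [B BE] : exists B, B = (U :\ x) :\: A by eexists.
have inB z : (z \in B) = [&& z \notin A, z != x & z \in U] by rewrite BE !inE.
rewrite -BE.
have [H|nAB] := boolP [exists u in A, exists v in B, G u v].
  by have [u uA /exists_inP[v vB Guv]] := exists_inP H; exists u, v.
have {}nAB u v : u \in A -> v \in B -> ~~ G u v.
  move=> uA vB; apply: contraNN nAB => Guv; apply/exists_inP; exists u => //.
  by apply/exists_inP; exists v.
have xA : x \notin A by apply/negP => /(subsetP AU); rewrite !inE eqxx.
have xB : x \notin B by rewrite inB eqxx andbF.
have AU' : A \subset U := subset_trans AU (subsetDl _ _).
have BU : B \subset U by apply/subsetP => z; rewrite inB => /and3P[].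
have part z : z \in U -> [|| z == x, z \in A | z \in B].
  by rewrite inB => ->; case: (z == x); case: (z \in A).
have dAB z : z \in A -> z \notin B by rewrite inB => ->.
have [|y [y' [yA y'A Gyx]]] := conn A AU' A0.
  by apply: contraNneq xA => ->.
have {y' y'A}Gyx : G y x.
  move: y'A; rewrite inE => /andP[y'A /part]; rewrite (negPf y'A) /=.
  by case/orP=> [/eqP <- //|/(nAB _ _ yA)]; rewrite Gyx.
have [||z [z' [zB z'B Gzx]]] := conn B BU.
- by apply: contraNneq AnU => /eqP; rewrite BE setD_eq0 => sub; rewrite eqEsubset AU.
- by apply: contraNneq xB => ->.
have {z' z'B}Gzx : G z x.
  move: z'B; rewrite inE => /andP[z'B /part]; rewrite (negPf z'B) orbF.
  by case/orP=> [/eqP <- //|z'A]; have := nAB _ _ z'A zB; rewrite sym Gzx.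
have yU := subsetP AU' _ yA; have zU := subsetP BU _ zB.
rewrite sym in Gyx; rewrite sym in Gzx.
have [S [SU xS yS lt_S HS]] := alpha_criticalP crit xU yU Gyx.
have [S' [S'U xS' zS' lt_S' HS']] := alpha_criticalP crit xU zU Gzx.
have cardE (R : {set T}) : R \subset U -> x \in R -> #|R| = (#|R :&: A| + #|R :&: B|).+1.
  move=> RU xR; rewrite (cardsD1 x R) xR -(cardsID A (R :\ x)); congr (_ + _).+1.
    apply: eq_card => w; rewrite !inE; case wA: (w \in A); rewrite ?andbF // !andbT.
    by case: eqP xA => [<-|]; rewrite ?wA.
  apply: eq_card => w; rewrite !inE inB; case wR: (w \in R); rewrite ?andbF //= andbT.
  by rewrite (subsetP RU _ wR) andbT.
have dis (R R' : {set T}) : [disjoint R :&: A & R' :&: B].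
  rewrite -setI_eq0; apply/eqP/setP => w; rewrite !inE.
  by case wA: (w \in A); rewrite ?andbF //= (negPf (dAB w wA)) !andbF.
(* The only neighbour of x in S' is z, which lies in B, and in S it is y, which lies in A. The
   exchanged set omits both, so x can be added to it. *)
have le1 : #|S' :&: A| + #|S :&: B| < alpha G U.
  have -> : (#|S' :&: A| + #|S :&: B|).+1 = #|x |: (S' :&: A :|: S :&: B)|.
    rewrite cardsU1 !inE (negPf xA) (negPf xB) !andbF add1n; congr _.+1.
    by rewrite cardsU (disjoint_setI0 (dis _ _)) cards0 subn0.
  apply: leq_alpha.
    by rewrite !subUset sub1set xU !subIset ?S'U ?SU.
  apply: stableU1 => // [w|].
    rewrite inE => /orP[|] /setIP[wS wAB]; apply/negP => Gxw.
      have [[_ E]|[_ E]] := HS' x w xS' wS Gxw; last by rewrite E in wAB; case/negP: xA.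
      by rewrite E in wAB; have := dAB _ wAB; rewrite zB.
    have [[_ E]|[_ E]] := HS x w xS wS Gxw; last by rewrite E in wAB; case/negP: xB.
    by rewrite E in wAB; have := dAB _ yA; rewrite wAB.
  apply/stableP => u v; rewrite !inE => /orP[] /andP[uS uAB] /orP[] /andP[vS vAB].
  - apply/negP => Guv; have [[E _]|[_ E]] := HS' u v uS vS Guv.
      by rewrite E (negPf xA) in uAB.
    by rewrite E (negPf xA) in vAB.
  - exact: nAB.
  - by rewrite sym; apply: nAB.
  - apply/negP => Guv; have [[E _]|[_ E]] := HS u v uS vS Guv.
      by rewrite E (negPf xB) in uAB.
    by rewrite E (negPf xB) in vAB.
have le2 : #|S :&: A| + #|S' :&: B| <= alpha G U.
  have -> : #|S :&: A| + #|S' :&: B| = #|S :&: A :|: S' :&: B|.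
    by rewrite cardsU (disjoint_setI0 (dis _ _)) cards0 subn0.
  apply: leq_alpha.
    by rewrite !subUset !subIset ?S'U ?SU.
  apply/stableP => u v; rewrite !inE => /orP[] /andP[uS uAB] /orP[] /andP[vS vAB].
  - apply/negP => Guv; have [[E _]|[_ E]] := HS u v uS vS Guv.
      by rewrite E (negPf xA) in uAB.
    by rewrite E (negPf xA) in vAB.
  - exact: nAB.
  - by rewrite sym; apply: nAB.
  - apply/negP => Guv; have [[E _]|[_ E]] := HS' u v uS vS Guv.
      by rewrite E (negPf xB) in uAB.
    by rewrite E (negPf xB) in vAB.
have := cardE S SU xS; have := cardE S' S'U xS'.
by move: lt_S lt_S' le1 le2; clear; lia.
Qed.

Lemma C5_embedding (T : finType) (G : rel T) (U : {set T}) (s : seq T) :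
  symmetric G -> irreflexive G -> size s = 5 -> uniq s -> {subset U <= s} ->
  (forall x0, [/\ G (nth x0 s 0) (nth x0 s 1), G (nth x0 s 1) (nth x0 s 2),
      G (nth x0 s 2) (nth x0 s 3), G (nth x0 s 3) (nth x0 s 4) &
      G (nth x0 s 4) (nth x0 s 0)]) ->
  (forall x0, [/\ ~~ G (nth x0 s 0) (nth x0 s 2), ~~ G (nth x0 s 0) (nth x0 s 3),
      ~~ G (nth x0 s 1) (nth x0 s 3), ~~ G (nth x0 s 1) (nth x0 s 4) &
      ~~ G (nth x0 s 2) (nth x0 s 4)]) ->
  exists f : T -> 'I_5, {in U &, injective f} /\
    {in U &, forall u v, cycle_graph 5 (f u) (f v) = G u v}.
Proof.
move=> sym irr s5 us Us Ge Gn.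
(* Outside [s] the index is 5 and [inord] returns a default value, but only vertices of [U]
   matter. *)
exists (fun z => inord (index z s)); split=> u v /Us u5 /Us v5.
  have iu : index u s < 5 by rewrite -s5 index_mem.
  have iv : index v s < 5 by rewrite -s5 index_mem.
  move/(congr1 val); rewrite /= !inordK // => E.
  by rewrite -(nth_index u u5) E nth_index.
have iu : index u s < 5 by rewrite -s5 index_mem.
have iv : index v s < 5 by rewrite -s5 index_mem.
rewrite /cycle_graph -val_eqE /= !inordK //.
rewrite -[in RHS](nth_index u u5) -[in RHS](nth_index u v5).
have [e1 e2 e3 e4 e5] := Ge u; have [] := Gn u.
move=> /negPf n1 /negPf n2 /negPf n3 /negPf n4 /negPf n5.
move: (index u s) (index v s) iu iv.
by case=> [|[|[|[|[|i]]]]] // -[|[|[|[|[|j]]]]] // _ _ /=;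
  rewrite ?irr ?e1 ?e2 ?e3 ?e4 ?e5 ?n1 ?n2 ?n3 ?n4 ?n5 //
    sym ?e1 ?e2 ?e3 ?e4 ?e5 ?n1 ?n2 ?n3 ?n4 ?n5.
Qed.

Lemma card_nbrs_shape (T : finType) (G : rel T) (U : {set T}) x a c i0 :
  irreflexive G -> tc_shape G U x a c i0 ->
  #|nbrs G U x| = #|U|.-1 %/ a + a.-1.
Proof.
move=> irr [[ca cE] [i0a full] s0 d1 _].
have -> : nbrs G U x = nbrs G (U :\ x) x.
  by apply/setP => z; rewrite !inE; have [->|] := eqVneq z x; rewrite ?irr ?andbF.
have caN : {in nbrs G (U :\ x) x, forall z, c z < a}.
  by move=> z; rewrite inE => /andP[/ca].
rewrite -(sum_card_cls caN) (bigD1 (Ordinal i0a)) //=.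
have clsE (j : nat) : cls (nbrs G (U :\ x) x) c j = nbrs G (cls (U :\ x) c j) x.
  by apply/setP => z; rewrite !inE andbAC.
congr (_ + _).
  rewrite clsE -s0; apply: eq_card => z; rewrite [LHS]inE andb_idr // inE => /andP[zU /eqP cz].
  exact: full.
rewrite (eq_bigr (fun=> 1)) => [|j ji0]; last by rewrite clsE d1.
by rewrite sum1_card cardC1 card_ord.
Qed.

Lemma pred_mul_divn a d : 0 < a -> 0 < d -> (a * d).-1 %/ a = d.-1.
Proof.
case: a d => [|a] [|d] // _ _; have -> : (a.+1 * d.+1).-1 = d * a.+1 + a by lia.
by rewrite divnMDl // divn_small // addn0.
Qed.

Lemma nbrsD1 (T : finType) (G : rel T) (U : {set T}) x y :
  x \in U -> #|nbrs G U y| = G y x + #|nbrs G (U :\ x) y|.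
Proof.
move=> xU; rewrite (cardsD1 x) inE xU; congr (_ + _).
by apply: eq_card => z; rewrite !inE andbA.
Qed.

Lemma clique_of_alpha1 (T : finType) (G : rel T) (U : {set T}) :
  symmetric G -> irreflexive G -> alpha G U <= 1 ->
  {in U &, forall x y, x != y -> G x y}.
Proof.
move=> sym irr a1 x y xU yU xy; apply: contraLR a1 => nGxy; rewrite -ltnNge.
have -> : 2 = #|[set x; y]| by rewrite cards2 xy.
apply: leq_alpha; first by rewrite subUset !sub1set xU.
by apply/stableP => u v; rewrite !inE => /orP[] /eqP -> /orP[] /eqP ->; rewrite ?irr // sym.
Qed.

(* The d non-neighbours of x other than x form a clique containing y and its unique neighbour b
   in the second clique of G - x - y; as y and b have no common neighbour, d = 2. *)
Lemma critical_extremal_C5 (T : finType) (G : rel T) (U : {set T}) x y c i0 :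
  let d := #|nbrs G U x| in let W := U :\ x :\ y in let a := alpha G U in
  symmetric G -> irreflexive G -> x \in U -> y \in U :\ x -> 0 < d ->
  {in U, forall z, #|nbrs G U z| <= d} -> 1 < a -> #|U| = (a * d).+1 ->
  tc_shape G (U :\ x) y a c i0 -> is_C5 G U.
Proof.
move=> /= sym irr xU yUx; set d := #|_|; set W := U :\ x :\ y.
have yU : y \in U by case/setD1P: yUx.
have yx : y != x by case/setD1P: yUx.
move=> d_gt0 max_d a_gt1 nE shape.
have Uxp : #|U :\ x| = alpha G U * d by move: nE; rewrite (cardsD1 x U) xU => -[].
have Wp : #|W| = (alpha G U * d).-1 by rewrite -Uxp (cardsD1 y (U :\ x)) yUx.
have qd : (alpha G U * d).-1 %/ alpha G U = d.-1.
  by apply: pred_mul_divn => //; apply: ltnW.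
have degy := card_nbrs_shape irr shape; rewrite Uxp qd in degy.
have [col [i0a full] s0 d1 _] := shape; have [ca cE] := col.
rewrite Uxp qd in s0; rewrite -/W in col ca cE full s0 d1.
have le_degy := max_d y yU; rewrite (nbrsD1 _ _ xU) degy in le_degy.
(* The hub y has degree (d - 1) + (a - 1) in G - x, and at most d in G; hence a = 2, and y is not
   adjacent to x. *)
have a2 : alpha G U = 2 by move: a_gt1 d_gt0 le_degy; clear; lia.
have nyx : ~~ G y x by move: le_degy; rewrite a2; case: (G y x) => //; move: d_gt0; clear; lia.
rewrite a2 in ca i0a d1 Uxp Wp nE.
have [j1 [j1a ji0 jP]] : exists j1, [/\ j1 < 2, j1 != i0 & forall j, j < 2 -> j != i0 -> j = j1].
  by exists (1 - i0); case: (i0) i0a => [|[|]] // _; split=> // -[|[|]].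
have cW z : z \in W -> c z = i0 \/ c z = j1.
  move=> zW; have [|ne] := eqVneq (c z) i0; [by left | right].
  exact: jP (ca z zW) ne.
pose B := cls W c j1.
have sB : #|B| = d.
  have := sum_card_cls ca; rewrite (bigD1 (Ordinal i0a)) //= s0 Wp.
  rewrite (big_pred1 (Ordinal j1a)) => [|j]; last first.
    by apply/idP/eqP => [ji|->]; [apply/val_inj/jP => /= | exact: ji0].
  by rewrite -/B; move: d_gt0; clear; lia.
have /eqP/cards1P[b bP] := d1 j1 j1a ji0.
have bE z : (z \in B) && G y z = (z == b) by have /setP/(_ z) := bP; rewrite !inE.
have /andP[bB Gyb] : (b \in B) && G y b by rewrite bE.
have bW : b \in W by move: bB; rewrite inE => /andP[].
have cb : c b = j1 by move: bB; rewrite inE => /andP[_ /eqP].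
have WU : {subset W <= U} by move=> z; rewrite !inE => /and3P[].
have Wx z : z \in W -> z != x by rewrite !inE => /and3P[].
have Wy z : z \in W -> z != y by rewrite !inE => /and3P[].
(* Inside G - x the vertex b is already adjacent to y and to the d - 1 other vertices of B, so no
   room is left for x. *)
have le_degb : d <= #|nbrs G (U :\ x) b|.
  have <- : #|y |: (B :\ b)| = d.
    rewrite -sB (cardsD1 b B) bB cardsU1 !inE; congr (_ + _).
    by rewrite eqxx !andbF.
  apply/subset_leq_card/subsetP => z /setU1P[->|/setD1P[zb zB]].
    by rewrite inE yUx sym.
  have zW : z \in W by move: zB; rewrite inE => /andP[].
  rewrite !inE Wx // WU //= cE // cb eq_sym zb /=.
  by move: zB; rewrite inE eq_sym => /andP[].
have nbx : ~~ G b x.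
  by have := max_d b (WU b bW); rewrite (nbrsD1 _ _ xU); case: (G b x) => //; move: le_degb;
    clear; lia.
pose F := far G U x.
have cliqueF : {in F &, forall u v, u != v -> G u v}.
  by apply: clique_of_alpha1 => //; rewrite -ltnS -a2 alpha_far.
have yF : y \in F by rewrite !inE yU yx sym.
have bF : b \in F by rewrite !inE WU // Wx // sym.
have yb : y != b by apply: contraTneq Gyb => ->; rewrite irr.
have FE : F = [set y; b].
  apply/eqP; rewrite eqEsubset subUset !sub1set yF bF !andbT; apply/subsetP => z zF.
  rewrite !inE; apply: contraT; rewrite negb_or => /andP[zy zb].
  have zW : z \in W by move: zF; rewrite !inE zy => /and3P[-> ->].
  have := cliqueF z b zF bF zb; rewrite cE // zb cb => /eqP cz.
  have Gyz : G y z by apply: cliqueF => //; rewrite eq_sym.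
  by have := bE z; rewrite Gyz inE zW cz eqxx (negPf zb).
have d2 : d = 2.
  have := card_far irr xU; rewrite -/F FE cards2 yb nE -/d; clear; lia.
have /eqP/cards1P[p pP] : #|cls W c i0| = 1 by rewrite s0 d2.
have /eqP/cards1P[r rP] : #|B :\ b| = 1.
  by move: sB; rewrite (cardsD1 b B) bB d2 => -[].
have pE z : (z \in W) && (c z == i0) = (z == p) by have /setP/(_ z) := pP; rewrite !inE.
have rE z : (z != b) && (z \in B) = (z == r) by have /setP/(_ z) := rP; rewrite !inE.
have /andP[pW /eqP cp] : (p \in W) && (c p == i0) by rewrite pE.
have /andP[rb rB] : (r != b) && (r \in B) by rewrite rE.
have rW : r \in W by move: rB; rewrite inE => /andP[].
have cr : c r = j1 by move: rB; rewrite inE => /andP[_ /eqP].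
have pb : p != b by apply: contraNneq ji0 => pb; rewrite -cb -pb cp.
have pr : p != r by apply: contraNneq ji0 => pr; rewrite -cr -pr cp.
have Gx z : z \in W -> z != b -> G x z.
  move=> zW zb; have : z \notin F by rewrite FE !inE negb_or Wy.
  by rewrite !inE WU // Wx //= negbK.
split; [by rewrite nE d2 | by [] |].
apply: (C5_embedding (s := [:: x; p; y; b; r])) => //=.
- by rewrite !inE !negb_or ![x == _]eq_sym yx !Wx // Wy // pb pr yb [y == r]eq_sym Wy //
  [b == r]eq_sym rb.
- move=> z zU; rewrite !inE; have [//|zx] := eqVneq z x; have [|zy] := eqVneq z y;
  first by rewrite !orbT.
  have zW : z \in W by rewrite !inE zx zy.
  have [cz|cz] := cW z zW; first by rewrite -pE zW cz eqxx.
  have [|zb] := eqVneq z b; first by rewrite !orbT.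
  by rewrite -(rE z) zb inE zW cz eqxx !orbT.
- move=> _; split; first exact: Gx.
  + by rewrite sym full.
  + exact: Gyb.
  + by rewrite cE // cb cr eqxx eq_sym rb.
  + by rewrite sym Gx.
- move=> _; split.
  + by rewrite sym.
  + by rewrite sym.
  + by rewrite cE // cp cb [i0 == _]eq_sym (negPf ji0) andbF.
  + by rewrite cE // cp cr [i0 == _]eq_sym (negPf ji0) andbF.
  + by have := bE r; rewrite rB (negPf rb) /= => ->.
Qed.

(** G - x is connected with unchanged stability number, so the inductive bound applies to it, while
    F(G - N[x]) is bounded by the Turan count for a - 1. *)
Lemma fib_bounded_critical (T : finType) (G : rel T) (U : {set T}) :
  symmetric G -> irreflexive G -> cut_connected G U -> alpha_critical G U ->
  1 < alpha G U ->
  {in U, forall x, cut_connected G (U :\ x) ->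
     fib_bounded G (U :\ x) /\
     (fib G (U :\ x) = tconn #|U :\ x| (alpha G (U :\ x)) ->
        has_hub G (U :\ x) \/ is_C5 G (U :\ x))} ->
  fib_bounded G U /\ (fib G U = tconn #|U| (alpha G U) -> is_C5 G U).
Proof.
move=> sym irr conn crit a_gt1 IH; rewrite /fib_bounded.
have U_gt1 : 1 < #|U| := leq_trans a_gt1 (alpha_le_card G U).
have [x0 x0U] : exists x0, x0 \in U by apply/card_gt0P; lia.
have [x xU max_x] := max_degree G x0U.
have a_U := cut_connected_alpha_lt conn U_gt1.
have connx := alpha_critical_no_cut sym irr conn crit xU.
have [w wU Gxw] : exists2 w, w \in U & G x w.
  have xsU : [set x] \subset U by rewrite sub1set.
  have [||y [z [yx zU Gyz]]] := conn _ xsU.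
  - by apply/set0Pn; exists x; rewrite inE.
  - by apply: contraTneq U_gt1 => <-; rewrite cards1.
  by exists z; [case/setDP: zU | rewrite -(set1P yx)].
have aUx := alpha_critical_del crit xU wU Gxw.
have [IH1 IH2] := IH x xU connx; rewrite /fib_bounded in IH1.
have Uxp : #|U :\ x| = #|U|.-1 by rewrite (cardsD1 x U) xU.
rewrite aUx Uxp in IH1 IH2.
have aF : alpha G (far G U x) <= (alpha G U).-1.
  by rewrite -ltnS prednK ?alpha_far // ltnW.
have [leF _] := fib_le_turan sym irr aF.
have cardF := card_far irr xU.
have fU := fib_rec sym irr xU.
have d_gt0 : 0 < #|nbrs G U x| by apply/card_gt0P; exists w; rewrite inE wU.
(* By connectedness every nonempty part of U - x has a vertex with an edge leaving it, hence of
   degree below d within it; so G - x is (d - 1)-degenerate. *)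
have aD : #|U|.-1 <= alpha G U * #|nbrs G U x|.
  rewrite -Uxp -aUx -[in leqRHS](prednK d_gt0).
  apply: alpha_degenerate => // V VUx V0.
  have VU := subset_trans VUx (subsetDl _ _).
  have [|v [z [vV zV Gvz]]] := conn V VU V0.
    by apply: contraTneq VUx => ->; apply/subsetPn; exists x; rewrite ?inE ?eqxx.
  exists v => //; rewrite -ltnS prednK //.
  apply: leq_trans (max_x v (subsetP VU _ vV)); apply: proper_card.
  apply/properP; split.
    by apply/subsetP => t; rewrite !inE => /andP[/(subsetP VU) -> ->].
  by case/setDP: zV => zU zV; exists z; rewrite inE ?zU // (negPf zV).
have [k_le|d_lt] := ltnP (#|U|.-1 %/ alpha G U) #|nbrs G U x|.
  have lt_f : fib G U < tconn #|U| (alpha G U).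
    rewrite fU; apply: leq_ltn_trans (tconn_step (_ : 1 < _ < _)); last by rewrite a_gt1.
    apply: leq_add IH1 (leq_trans leF (turan_le _ _)).
    by move: cardF k_le; clear; lia.
  by split; [exact: ltnW | move=> E; rewrite E ltnn in lt_f].
have nE : #|U| = (alpha G U * #|nbrs G U x|).+1.
  have := leq_divM #|U|.-1 (alpha G U).
  move: (_ %/ _) d_lt aD U_gt1 => q qd aD' U1 qa.
  by move: aD' U1; have := leq_mul qd (leqnn (alpha G U)); move: qa; clear; lia.
have step := tconn_step_eq (ltnW a_gt1) d_gt0; rewrite -nE in step.
have Upd : #|U|.-1 = alpha G U * #|nbrs G U x| by rewrite [in LHS]nE.
have farE : #|far G U x| = alpha G U * #|nbrs G U x| - #|nbrs G U x|.
  by move: cardF nE; clear; lia.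
rewrite Upd in IH1 IH2; rewrite farE in leF.
rewrite fU -step; split; first exact: leq_add.
move=> E; have {}E : fib G (U :\ x) = tconn (alpha G U * #|nbrs G U x|) (alpha G U).
  by move: E IH1 leF; clear; lia.
(* G - x is not a 5-cycle, since its order a d would be both 2d and 5. *)
have [[y yUx hub]|[U5 a2 _]] := IH2 E; last first.
  by move: U5; rewrite Uxp Upd -aUx a2; clear; lia.
have aVlt : alpha G (U :\ x) < #|U :\ x|.
  by apply: cut_connected_alpha_lt => //; rewrite Uxp; move: a_U a_gt1; clear; lia.
have EV : fib G (U :\ x) = tconn #|U :\ x| (alpha G (U :\ x)) by rewrite E aUx Uxp Upd.
have [c [i0 shape]] := tc_structure sym irr connx yUx aVlt EV hub.
rewrite aUx in shape.
by apply: critical_extremal_C5 shape.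
Qed.

(** * The bound for connected graphs *)

Lemma del_edge_sym (T : finType) (G : rel T) x y : symmetric G -> symmetric (del_edge G x y).
Proof.
by move=> sym u v; rewrite /del_edge sym orbC; do !congr (_ && _); rewrite andbC [X in _ || X]andbC.
Qed.

Lemma stable_del_edge (T : finType) (G : rel T) x y (S : {set T}) :
  stable G S -> stable (del_edge G x y) S.
Proof.
move=> /stableP st; apply/stableP => u v uS vS.
by rewrite /del_edge (negPf (st u v uS vS)).
Qed.

Lemma alpha_del_edge (T : finType) (G : rel T) x y (U : {set T}) :
  alpha G U <= alpha (del_edge G x y) U.
Proof.
have [S [SU stS <-]] := alpha_witness G U.
by apply: leq_alpha => //; apply: stable_del_edge.
Qed.

Lemma fib_del_edge (T : finType) (G : rel T) x y (U : {set T}) :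
  irreflexive G -> x \in U -> y \in U -> G x y -> fib G U < fib (del_edge G x y) U.
Proof.
move=> irr xU yU Gxy; apply: proper_card; apply/properP; split.
  apply/subsetP => S; rewrite !inE => /andP[-> /=]; exact: stable_del_edge.
exists [set x; y]; rewrite inE subUset !sub1set xU yU /=; last first.
  by apply/negP => /stableP/(_ x y); rewrite !inE !eqxx orbT Gxy => /(_ isT isT).
apply/stableP => u v; rewrite !inE /del_edge.
by move=> /orP[] /eqP -> /orP[] /eqP ->; rewrite ?irr ?eqxx ?andbF ?orbT ?andbF.
Qed.

Lemma card_del_edge (T : finType) (G : rel T) x y : G x y ->
  #|[set p : T * T | del_edge G x y p.1 p.2]| < #|[set p : T * T | G p.1 p.2]|.
Proof.
move=> Gxy; apply: proper_card; apply/properP; split.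
  by apply/subsetP => p; rewrite !inE => /andP[].
by exists (x, y); rewrite !inE //= /del_edge !eqxx andbF.
Qed.

Lemma fib_alpha1 (T : finType) (G : rel T) (U : {set T}) x :
  symmetric G -> irreflexive G -> x \in U -> alpha G U = 1 ->
  fib_bounded G U /\ (fib G U = tconn #|U| (alpha G U) -> has_hub G U).
Proof.
move=> sym irr xU a1; have U_gt0 : 0 < #|U| by apply/card_gt0P; exists x.
have [le_t _] := fib_le_turan sym irr (leqnn (alpha G U)).
rewrite /fib_bounded a1 tconn1 // in le_t *; split=> // E; exists x => //.
have F0 : far G U x = set0.
  apply/eqP; rewrite -subset0; apply/subsetP => z zF.
  by have := alpha_far sym irr xU; rewrite a1 ltnS leqNgt (alpha_gt0 irr zF).
move: E; rewrite (fib_rec sym irr xU) F0 fib_set0 a1 turan_rec //.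
by rewrite [turan _ 1.-1]balprodn0 => /addIn.
Qed.

(** The outer induction on the order covers all graphs on the vertex type, so it serves G - x and
    both sides of a bridge; the inner one, on adjacent ordered pairs, serves edge deletion. *)
Theorem fib_le_tconn (T : finType) (G : rel T) (U : {set T}) :
  symmetric G -> irreflexive G -> U != set0 -> cut_connected G U ->
  fib_bounded G U /\
  (fib G U = tconn #|U| (alpha G U) -> has_hub G U \/ is_C5 G U).
Proof.
elim: {U}#|U|.+1 {-2}U (ltnSn #|U|) G => [//|n IHn] U Un G.
elim: {G}#|[set p : T * T | G p.1 p.2]|.+1 {-2}G (ltnSn #|[set p : T * T | G p.1 p.2]|)
  => [//|m IHm] G Gm sym irr U0 conn.
have [x0 x0U] := set0Pn _ U0.
have [a_le1|a_gt1] := leqP (alpha G U) 1.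
  have a1 : alpha G U = 1 by apply/eqP; rewrite eqn_leq a_le1 (alpha_gt0 irr x0U).
  by have [? H] := fib_alpha1 sym irr x0U a1; split=> // /H; left.
have [|crit] := boolP [exists x in U, exists y in U, G x y &&
  (alpha (del_edge G x y) U <= alpha G U)]; last first.
  have {}crit : alpha_critical G U.
    move=> x y xU yU Gxy; rewrite ltnNge; apply: contraNN crit => le_a.
    by apply/exists_inP; exists x => //; apply/exists_inP; exists y; rewrite ?Gxy.
  have [|le_f eq_f] := fib_bounded_critical sym irr conn crit a_gt1.
    move=> x xU connx; apply: IHn => //; first by move: Un; rewrite (cardsD1 x U) xU.
    have := leq_trans a_gt1 (alpha_le_card G U); rewrite (cardsD1 x U) xU ltnS.
    by rewrite card_gt0.
  by split=> // /eq_f; right.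
case/exists_inP=> x xU /exists_inP[y yU /andP[Gxy safe]].
pose G' := del_edge G x y.
have aE : alpha G' U = alpha G U by apply/eqP; rewrite eqn_leq safe alpha_del_edge.
have sub' u v : G' u v -> G u v by case/andP.
have sym' : symmetric G' := del_edge_sym x y sym.
(* Either G - xy is still connected, and deleting xy has made the new stable set {x, y}, or some A
   has no edge leaving it in G - xy and xy is a bridge. *)
have [/existsP[A /and4P[AU A0 AnU nG']]|nA] := boolP [exists A : {set T},
    [&& A \subset U, A != set0, A != U & [forall u in A, forall v in U :\: A, ~~ G' u v]]];
      last first.
  have conn' : cut_connected G' U.
    move=> A AU A0 AnU; move: nA; rewrite negb_exists => /forallP/(_ A); rewrite AU A0 AnU /=.
    rewrite negb_forall_in => /exists_inP[u uA]; rewrite negb_forall_in => /exists_inP[v vA].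
    by rewrite negbK => Guv; exists u, v.
  have irr' : irreflexive G' by move=> u; rewrite /G' /del_edge irr.
  have [le_f _] := IHm G' (leq_trans (card_del_edge Gxy) Gm) sym' irr' U0 conn'.
  have lt_f : fib G U < tconn #|U| (alpha G U).
    by rewrite -aE; apply: leq_trans le_f; apply: fib_del_edge.
  by split; [exact: ltnW | move=> E; rewrite E ltnn in lt_f].
have {}nG' u v : u \in A -> v \in U :\: A -> ~~ G' u v.
  by move=> uA; have /forall_inP H := forall_inP nG' u uA; apply: H.
have [u [v [uA vB Guv]]] := conn A AU A0 AnU.
pose B := U :\: A; have UE : U = A :|: B by rewrite /B setDE setUIr setUCr setIT (setUidPr AU).
have dAB : [disjoint A & B] by rewrite -setI_eq0 /B setIDA setIC -setIDA setDv setI0.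
have edge s t : s \in A -> t \in B -> G s t -> s = x /\ t = y \/ s = y /\ t = x.
  move=> sA tB Gst; have := nG' s t sA tB; rewrite /G' /del_edge Gst negbK.
  by case/orP=> /andP[/eqP -> /eqP ->]; [left | right].
have bridge : {in A & B, forall s t, G s t -> s = u /\ t = v}.
  move=> s t sA tB Gst; have uB w : w \in A -> w \in B -> False by move=> ?;
    rewrite inE => /andP[/negP].
  have [[us ut]|[us ut]] := edge u v uA vB Guv; have [[ss st]|[ss st]] := edge s t sA tB Gst.
  - by rewrite us ut.
  - by case: (uB y); [rewrite -ss | rewrite -ut].
  - by case: (uB x); [rewrite -ss | rewrite -ut].
  - by rewrite us ut.
have bridge' : {in B & A, forall s t, G s t -> s = v /\ t = u}.
  by move=> s t sB tA; rewrite sym => /(bridge t s tA sB)[].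
(* The lower bound uses that xy is safe: the union of stable sets of A and B is stable in G - xy,
   whose stability number is that of G. *)
have alphaE : alpha G U = alpha G A + alpha G B.
  apply/eqP; rewrite eqn_leq; apply/andP; split.
    have [S [SU stS <-]] := alpha_witness G U.
    rewrite -(cardsID A S) leq_add // leq_alpha ?subsetIr ?setSD //.
      by apply: stable_sub stS; apply: subsetIl.
    by apply: stable_sub stS; apply: subsetDl.
  have [S [SA stS <-]] := alpha_witness G A; have [S' [SB stS' <-]] := alpha_witness G B.
  have -> : #|S| + #|S'| = #|S :|: S'|.
    by rewrite cardsU disjoint_setI0 ?cards0 ?subn0 // (disjointWl SA) // (disjointWr SB).
  rewrite -aE; apply: leq_alpha; first by rewrite UE setUSS.
  have st := stable_del_edge x y stS; have st' := stable_del_edge x y stS'.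
  apply/stableP => s t /setUP[] sS /setUP[] tS.
  - exact: (stableP _ _ st).
  - by apply: nG'; [apply: (subsetP SA) | apply: (subsetP SB)].
  - by rewrite sym'; apply: nG'; [apply: (subsetP SA) | apply: (subsetP SB)].
  - exact: (stableP _ _ st').
have connA : cut_connected G A.
  by apply: (cut_connected_side sym dAB uA bridge); rewrite -UE.
have connB : cut_connected G B.
  apply: (cut_connected_side sym _ vB bridge'); first by rewrite disjoint_sym.
  by rewrite setUC -UE.
have cU : #|U| = #|A| + #|B| by rewrite {1}UE cardsU disjoint_setI0 // cards0 subn0.
have A_gt0 : 0 < #|A| by rewrite card_gt0.
have B_gt0 : 0 < #|B| by apply/card_gt0P; exists v.
have [|leA _] := IHn A _ G sym irr A0 connA; first by move: Un A_gt0 B_gt0; rewrite cU; clear; lia.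
have [||leB _] := IHn B _ G sym irr _ connB; first by move: Un A_gt0 B_gt0; rewrite cU; clear; lia.
  by rewrite -card_gt0.
have := bridge_case sym irr dAB uA vB Guv bridge; rewrite -UE => /(_ alphaE leA leB)[le_f eq_f].
by split=> // /eq_f; left.
Qed.

(** * The graphs TC_{n,a} and C_5 *)

Lemma cut_connectedT (T : finType) (G : rel T) :
  connected_graph G -> cut_connected G [set: T].
Proof.
move=> conn A _ /set0Pn[x xA] AnT.
have [|nH] := boolP [exists u in A, exists v in [set: T] :\: A, G u v].
  by case/exists_inP=> u uA /exists_inP[v vA Guv]; exists u, v.
case/negP: AnT; apply/eqP/setP => y; rewrite inE.
have [p Gp ->] := connectP (conn x y).
elim: p x xA Gp => //= z p IH x xA /andP[Gxz Gp]; apply: IH Gp.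
apply: contraNT nH => zA; apply/exists_inP; exists x => //.
by apply/exists_inP; exists z => //; rewrite !inE zA.
Qed.

Lemma fib_setT (T : finType) (G : rel T) : fib G [set: T] = fib_index G.
Proof. by apply: eq_card => S; rewrite !inE subsetT. Qed.

Lemma alpha_setT (T : finType) (G : rel T) : alpha G [set: T] = stability_number G.
Proof. by apply: eq_bigl => S; rewrite subsetT. Qed.

Lemma fib_index_embed (T T' : finType) (G : rel T) (G' : rel T') (f : T -> T') :
  injective f -> (forall x y, G' (f x) (f y) = G x y) -> fib_index G <= fib_index G'.
Proof.
move=> f_inj fG; rewrite /fib_index -(card_imset _ (imset_inj f_inj)).
apply/subset_leq_card/subsetP => _ /imsetP[S + ->]; rewrite !inE => /stableP stS.
by apply/stableP => _ _ /imsetP[x xS ->] /imsetP[y yS ->]; rewrite fG stS.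
Qed.

Lemma fib_index_iso (T T' : finType) (G : rel T) (G' : rel T') :
  graph_iso G G' -> fib_index G = fib_index G'.
Proof.
case=> f [[g fK gK] fG]; apply/eqP; rewrite eqn_leq (fib_index_embed (can_inj fK) fG).
by apply: (fib_index_embed (can_inj gK)) => x y; rewrite -fG !gK.
Qed.

(** The vertex recursion on explicit lists, so that F of a concrete graph can be found by
    rewriting. *)
Lemma fib_cons (T : finType) (G : rel T) x (s : seq T) :
  symmetric G -> irreflexive G -> uniq (x :: s) ->
  fib G [set z in x :: s] =
  fib G [set z in s] + fib G [set z in [seq z <- s | ~~ G x z]].
Proof.
move=> sym irr /= /andP[xs us]; have xU : x \in [set z in x :: s] by rewrite inE mem_head.
rewrite (fib_rec sym irr xU); congr (fib G _ + fib G _); apply/setP => z; rewrite !inE.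
  by case: eqP => [->|] //=; rewrite (negPf xs).
by rewrite mem_filter andbC; case: eqP => [->|] //=; rewrite (negPf xs) ?andbF.
Qed.

Lemma cycle_graph_sym n : symmetric (cycle_graph n).
Proof. by move=> x y; rewrite /cycle_graph eq_sym orbC. Qed.

Lemma cycle_graph_irr n : irreflexive (cycle_graph n).
Proof. by move=> x; rewrite /cycle_graph eqxx. Qed.

Lemma fib_C5 : fib_index (cycle_graph 5) = 11.
Proof.
pose o i (h : i < 5) : 'I_5 := Ordinal h.
have -> : fib_index (cycle_graph 5) = fib (cycle_graph 5)
    [set z in [:: @o 0 isT; @o 1 isT; @o 2 isT; @o 3 isT; @o 4 isT]].
  rewrite -fib_setT; congr fib; apply/setP => -[[|[|[|[|[|z]]]]] hz] //; rewrite !inE -!val_eqE //.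
have H := fib_cons (@cycle_graph_sym 5) (@cycle_graph_irr 5).
have H0 : fib (cycle_graph 5) [set z in [::]] = 1.
  by rewrite -[RHS](fib_set0 (cycle_graph 5)); congr (fib _ _).
by do !(rewrite H //=); rewrite H0.
Qed.

(** The right side is the ceiling of (n - i)/a; as i < a, the subtraction never truncates. *)
Lemma count_modn n a i : i < a -> \sum_(z < n) (z %% a == i) = (n + a.-1 - i) %/ a.
Proof.
move=> ia; have a_gt0 : 0 < a by apply: leq_ltn_trans ia.
elim: n => [|n IH]; first by rewrite big_ord0 divn_small // add0n; lia.
rewrite big_ord_recr /= IH.
have -> : n.+1 + a.-1 - i = (n + a.-1 - i).+1 by lia.
rewrite divnS // addnC; congr (_ + _); congr nat_of_bool.
have -> : (n + a.-1 - i).+1 = n + (a - i) by lia.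
have -> : (n %% a == i) = (n == i %[mod a]) by rewrite (modn_small ia).
by rewrite -(eqn_modDr (a - i)) subnKC 1?ltnW // modnn.
Qed.

Lemma prod_threshold a u x y : u <= a ->
  \prod_(i < a) (if i < u then x else y) = x ^ u * y ^ (a - u).
Proof.
elim: a u => [|a IH] u; first by rewrite leqn0 => /eqP ->; rewrite big_ord0.
rewrite leq_eqVlt => /predU1P[->|ua].
  rewrite subnn muln1 (eq_bigr (fun=> x)) => [|i _]; last by rewrite ltn_ord.
  by rewrite prod_nat_const card_ord.
rewrite big_ord_recr /= IH // ltnNge -ltnS ua /= subSn // expnS.
by rewrite -mulnA [_ * y]mulnC.
Qed.

Lemma TC_graph_sym n a : symmetric (TC_graph n a).
Proof.
move=> x y; rewrite /TC_graph [y == x]eq_sym [_ %% a == _ in RHS]eq_sym.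
by congr (_ && (_ || _)); rewrite orbC.
Qed.

Lemma TC_graph_irr n a : irreflexive (TC_graph n a).
Proof. by move=> x; rewrite /TC_graph eqxx. Qed.

Lemma f_TC_closed n a : 0 < a <= n -> f_TC n a = tconn n a.
Proof.
case/andP=> a_gt0 an; have n_gt0 := leq_trans a_gt0 an.
have [u ua nE] := posn_decomp n_gt0 a_gt0.
move: (n.-1 %/ a) nE => q nE; rewrite [in RHS]nE tconnE //.
case: n n_gt0 an nE => // n _ an nE.
have [sym irr] := (@TC_graph_sym n.+1 a, @TC_graph_irr n.+1 a).
rewrite /f_TC -fib_setT (fib_rec sym irr (in_setT ord0)).
pose c (z : 'I_n.+1) := z %% a.
have col : colored (TC_graph n.+1 a) ([set: 'I_n.+1] :\ ord0) a c.
  split=> [z _|z w]; first exact: ltn_pmod.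
  rewrite !inE !andbT -!val_eqE /= /TC_graph => /negPf -> /negPf ->.
  by rewrite orbF.
(* With n = q a + u + 1, the residues 0, ..., u occur q + 1 times and the others q times. *)
have cls_size (i : nat) : i < a -> #|[set z : 'I_n.+1 | c z == i]| = q + (i <= u).
  move=> ia; rewrite -sum1_card big_mkcond /=.
  rewrite (eq_bigr (fun z : 'I_n.+1 => nat_of_bool (z %% a == i))); last first.
    by move=> z _; rewrite inE /c; case: (_ == _).
  rewrite count_modn // nE.
  have -> : q * a + u.+1 + a.-1 - i = q * a + (u + (a - i)) by lia.
  rewrite divnMDl //; congr (_ + _).
  have [iu|ui] := leqP i u; last by rewrite divn_small //; lia.
  have -> : u + (a - i) = a + (u - i) by lia.
  by rewrite divnDl // divnn a_gt0 divn_small // ltn_subLR //; lia.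
have colF := colored_sub (far_sub (TC_graph n.+1 a) _ _) col.
rewrite (fib_colored sym irr col) (fib_colored sym irr colF).
case: a a_gt0 an ua nE sym irr @c col colF cls_size => // a _ an ua nE sym irr c col colF cls_size.
have c0 : c ord0 = 0 by rewrite /c mod0n.
rewrite !big_ord_recl /=.
have -> : #|cls ([set: 'I_n.+1] :\ ord0) c 0|.+1 = q.+1.
  have := cls_size 0 isT; rewrite leq0n (cardsD1 ord0) inE c0 eqxx add1n addn1 => -[<-].
  by congr _.+1; apply: eq_card => z; rewrite !inE andbT.
have -> : #|cls (far (TC_graph n.+1 a.+1) [set: 'I_n.+1] ord0) c 0| = 0.
  apply: eq_card0 => z; rewrite !inE /TC_graph eq_sym mod0n [0 == _]eq_sym.
  by case: eqP => //= _; rewrite /c; case: (z %% a.+1 == 0); rewrite ?andbF.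
rewrite mul1n; congr (_ + _).
  rewrite (eq_bigr (fun i : 'I_a => if i < u then q.+2 else q.+1)) => [|i _].
    by rewrite prod_threshold // subSn // expnS -mulnA [q.+2 ^ u * _]mulnC.
  have := cls_size i.+1 (ltn_ord i); rewrite (_ : #|_| = #|cls ([set: 'I_n.+1] :\ ord0) c i.+1|).
    by move=> ->; case: (i < u); rewrite ?addn1 ?addn0.
  apply: eq_card => z; rewrite !inE andbT andb_idl // => /eqP cz.
  by apply/eqP => z0; rewrite z0 c0 in cz.
rewrite (eq_bigr (fun i : 'I_a => if i < u then q.+1 else q)) => [|i _].
  by rewrite prod_threshold // mulnC.
(* The neighbour of vertex 0 in class i + 1 is the vertex i + 1; it is the one that the class
   loses. *)
have i_n : i.+1 < n.+1 by apply: leq_trans an; rewrite ltnS.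
have := cls_size i.+1 (ltn_ord i); rewrite (cardsD1 (Ordinal i_n)) inE /c modn_small // ?eqxx;
  last exact: (ltn_ord i).
rewrite add1n => E; rewrite (_ : #|cls _ _ _| = #|[set z : 'I_n.+1 | c z == i.+1] :\ Ordinal i_n|).
  by rewrite E; case: (i < u); rewrite ?addn1 ?addn0.
apply: eq_card => z; rewrite !inE /TC_graph mod0n -!val_eqE /= [RHS]andbC.
rewrite /c; case cz: (z %% a.+1 == i.+1); rewrite ?andbF // andbT /=.
have z_gt0 : 0 < z by case: (nat_of_ord z) cz.
rewrite (eqP cz) [0 == nat_of_ord z]eq_sym -lt0n z_gt0 /= orbF.
apply/idP/idP; first by apply: contraNneq => ->; exact: (ltn_ord i).
by apply: contraNN => za; rewrite -(eqP cz) modn_small.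
Qed.

(* rho numbers the cliques as in TC_graph: i0 first, then the other cliques of size q + 1. *)
Lemma large_first a (s : nat -> nat) i0 q u : i0 < a ->
  (forall j, j < a -> q <= s j <= q.+1) -> s i0 = q -> \sum_(j < a) s j = q * a + u ->
  exists rho : nat -> nat, [/\ rho i0 = 0, forall j, j < a -> rho j < a,
    forall i j, i < a -> j < a -> rho i = rho j -> i = j &
    forall j, j < a -> s j = q.+1 -> rho j <= u].
Proof.
move=> i0a s_q s0 sum_s.
pose P1 j := (j != i0) && (s j == q.+1); pose P2 j := (j != i0) && (s j != q.+1).
pose L := i0 :: filter P1 (iota 0 a) ++ filter P2 (iota 0 a).
have memL j : (j \in L) = (j < a).
  rewrite inE mem_cat !mem_filter mem_iota /P1 /P2 add0n /=.
  by have [->|] //= := eqVneq j i0; case: (s j == _) => //=; rewrite ?orbF.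
have sizeP1 : size (filter P1 (iota 0 a)) = u.
  rewrite size_filter -sum1_count.
  have : \sum_(j < a) s j = \sum_(j < a) (q + P1 j).
    apply: eq_bigr => j _; rewrite /P1; have [->|ji0] /= := eqVneq (j : nat) i0.
      by rewrite s0 addn0.
    have := s_q j (ltn_ord j); case: eqP => [-> _|]; first by rewrite addn1.
    by rewrite addn0; move: (s j); clear; lia.
  rewrite sum_s big_split /= sum_nat_const card_ord mulnC => /addnI ->.
  by rewrite -(big_mkord xpredT (fun j => nat_of_bool (P1 j))) /index_iota subn0 big_mkcond.
exists (fun j => index j L); split.
- by rewrite /= eqxx.
- have uL : uniq L.
    rewrite /= mem_cat !mem_filter /P1 /P2 eqxx /= cat_uniq !filter_uniq ?iota_uniq //= andbT.
    apply/hasPn => j; rewrite !mem_filter /P1 /P2 => /andP[/andP[-> H] _] /=.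
    by rewrite (negPf H).
  have sL : size L = a.
    rewrite -[RHS](size_iota 0); apply/perm_size/uniq_perm; rewrite ?iota_uniq // => j.
    by rewrite memL mem_iota.
  by move=> j; rewrite -memL -index_mem sL.
- move=> i j ia ja E.
  by rewrite -(nth_index 0 (_ : i \in L)) ?memL // E nth_index // memL.
- move=> j ja sj; have [->|ji0] := eqVneq j i0; first by rewrite /= eqxx.
  have jP : j \in filter P1 (iota 0 a) by rewrite mem_filter /P1 ji0 sj eqxx mem_iota.
  by rewrite /= eq_sym (negPf ji0) index_cat jP -sizeP1 index_mem.
Qed.

(** Vertex z is sent to [idx z * a + rho (cc z)]: the residue names its clique and the quotient its
    position there. Position 0 is reserved for [rep], that is, for the hub and its one neighbour in
    each other clique, which therefore receive the values below a, as in [TC_graph]. *)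
Lemma tc_shape_iso (T : finType) (G : rel T) x a c i0 :
  symmetric G -> irreflexive G -> 0 < a ->
  tc_shape G [set: T] x a c i0 -> graph_iso G (TC_graph #|T| a).
Proof.
move=> sym irr a_gt0; rewrite /tc_shape cardsT.
set W := [set: T] :\ x => -[[ca cE] [i0a full] s0 d1 s_q].
have T_gt0 : 0 < #|T| by apply/card_gt0P; exists x.
have [u ua nE] := posn_decomp T_gt0 a_gt0.
set q := #|T|.-1 %/ a in nE s0 s_q.
have inW z : (z \in W) = (z != x) by rewrite !inE andbT.
have cardW : #|W| = q * a + u.
  by apply: succn_inj; rewrite -addnS -nE -[RHS]cardsT (cardsD1 x [set: T]) inE.
have sum_s : \sum_(j < a) #|cls W c j| = q * a + u by rewrite sum_card_cls.
have [rho [rho0 rho_lt rho_inj rho_u]] := large_first i0a s_q s0 sum_s.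
pose cc z := if z == x then i0 else c z.
pose rep z := (z == x) || (cc z != i0) && G x z.
pose K j := [set w | (cc w == j) && ~~ rep w].
pose idx z := if rep z then 0 else (index z (enum (K (cc z)))).+1.
have cc_lt z : cc z < a by rewrite /cc; case: eqP => // /eqP zx; apply: ca; rewrite inW.
have ccx : cc x = i0 by rewrite /cc eqxx.
have ccE z : z != x -> cc z = c z by rewrite /cc => /negPf ->.
have rep_x : rep x by rewrite /rep eqxx.
have rep_i0 z : rep z -> cc z = i0 -> z = x.
  by rewrite /rep => /orP[/eqP //|/andP[/eqP]].
have KE j : j < a -> #|K j| + (j != i0) = #|cls W c j|.
  move=> ja; have [->|ji0] := eqVneq j i0.
    rewrite addn0; apply: eq_card => w; rewrite !inE andbT /rep.
    have [->|wx] /= := eqVneq w x; first by rewrite andbF.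
    by rewrite ccE //; case: eqP.
  rewrite -(cardsID [set w | ~~ G x w] (cls W c j)); congr (_ + _).
    apply: eq_card => w; rewrite !inE andbT /rep.
    have [->|wx] /= := eqVneq w x; first by rewrite ccx eq_sym (negPf ji0).
    by rewrite ccE //; have [->|] //= := eqVneq (c w) j; rewrite ji0.
  rewrite /= -(d1 j ja ji0); apply: eq_card => w; rewrite !inE negbK.
  exact: andbC.
have idx_le z : idx z <= #|K (cc z)|.
  rewrite /idx; case: ifPn => // nrep.
  by rewrite cardE index_mem mem_enum inE eqxx.
(* Only cliques of order q + 1 reach position q, and those have number at most u, so the values stay
   at most q a + u. *)
have f_lt z : idx z * a + rho (cc z) < #|T|.
  have ja := cc_lt z; have := KE _ ja; have := idx_le z; rewrite nE addnS ltnS.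
  have [->|ji0] /= := eqVneq (cc z) i0.
    by rewrite rho0 !addn0 s0 => le1 <-; apply: leq_trans (leq_mul le1 (leqnn a)) (leq_addr _ _).
  rewrite addn1; have /andP[sq] := s_q _ ja.
  rewrite leq_eqVlt => /orP[/eqP E|]; rewrite ?ltnS.
    move=> le1; rewrite E => -[K_q]; rewrite -K_q.
    by apply: leq_add; [rewrite leq_mul | apply: rho_u].
  move=> le_q le1 K_q; have lt1 : idx z < q by apply: leq_ltn_trans le1 _; rewrite K_q.
  apply: leq_trans (leq_trans _ (leq_mul lt1 (leqnn a))) (leq_addr _ _).
  by rewrite mulSn addnC leq_add2r ltnW // rho_lt.
pose f z : 'I_#|T| := Ordinal (f_lt z).
have f_mod z : f z %% a = rho (cc z) by rewrite /= modnMDl modn_small // rho_lt.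
have f_div z : f z %/ a = idx z by rewrite /= divnMDl // divn_small ?addn0 // rho_lt.
have cc_inj z w : f z %% a = f w %% a -> cc z = cc w.
  by rewrite !f_mod => /rho_inj; apply.
have rep_cc z w : rep z -> rep w -> cc z = cc w -> z = w.
  move=> rz rw E; have [zi|zi] := eqVneq (cc z) i0.
    by rewrite (rep_i0 z rz zi) (rep_i0 w rw) // -E.
  have zx : z != x by apply: contraNneq zi => ->; rewrite ccx.
  have wx : w != x by apply: contraNneq zi => wx; rewrite E wx ccx.
  have /eqP/cards1P[y yP] := d1 _ (cc_lt z) zi.
  have yE v : v != x -> rep v -> cc v = cc z -> v = y.
    move=> vx rv cv; apply/set1P; rewrite -yP !inE andbT vx -cv -ccE // eqxx /=.
    by move: rv; rewrite /rep (negPf vx) => /andP[].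
  by rewrite (yE z) // (yE w).
have f_inj : injective f.
  move=> z w E; have Ec : cc z = cc w by apply: cc_inj; rewrite E.
  have : idx z = idx w by rewrite -!f_div E.
  rewrite /idx; case: ifPn => rz; case: ifPn => rw; [by move=> _;
    apply: rep_cc | by [] | by [] | case].
  rewrite -Ec => Ei; have zK : z \in enum (K (cc z)) by rewrite mem_enum inE eqxx.
  rewrite -(nth_index z zK) Ei nth_index // mem_enum inE rw.
  by rewrite Ec eqxx.
have f_rep z : (f z < a) = rep z.
  rewrite -[RHS](_ : (idx z == 0) = _); last by rewrite /idx; case: (rep z).
  by rewrite -f_div -[RHS]leqn0 [RHS]leqNgt divn_gt0 // -ltnNge.
have f_0 z : (f z == 0 :> nat) = (z == x).
  apply/eqP/eqP => [fz|->]; last by rewrite /= /idx rep_x ccx rho0.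
  have rz : rep z by rewrite -f_rep fz.
  apply: rep_i0 rz _; apply: rho_inj; rewrite ?cc_lt //.
  by rewrite -f_mod fz mod0n rho0.
exists f; split.
  apply: inj_card_bij f_inj _; by rewrite card_ord.
move=> z w; rewrite /TC_graph (inj_eq f_inj) !lt0n !f_0 !f_rep !f_mod.
have -> : (rho (cc z) == rho (cc w)) = (cc z == cc w).
  by apply/eqP/eqP => [/rho_inj->|->].
have Gx v : v != x -> G x v = (i0 == cc v) || rep v.
  move=> vx; rewrite /rep (negPf vx) /= eq_sym.
  have [cv|] //= := eqVneq (cc v) i0.
  by rewrite full ?inW // -ccE.
have [->|zw] /= := eqVneq z w; first by rewrite irr.
have [zx|zx] /= := eqVneq z x.
  have wx : w != x by rewrite eq_sym -zx.
  by rewrite (negPf wx) orbF zx ccx Gx.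
have [wx|wx] /= := eqVneq w x; first by rewrite wx ccx sym Gx // eq_sym.
by rewrite orbF cE ?inW // zw !ccE.
Qed.

Theorem mainTheorem9 (T : finType) (G : rel T) :
  symmetric G -> irreflexive G -> connected_graph G -> 2 <= #|T| ->
  let n := #|T| in
  let a := stability_number G in
  fib_index G <= f_TC n a /\
  ((n, a) <> (5, 2) -> (fib_index G = f_TC n a <-> graph_iso G (TC_graph n a))) /\
  ((n, a) = (5, 2) ->
     (fib_index G = f_TC n a <->
      graph_iso G (TC_graph 5 2) \/ graph_iso G (cycle_graph 5))).
Proof.
move=> sym irr /cut_connectedT conn T_gt1 n a.
have T_gt0 : 0 < #|[set: T]| by rewrite cardsT ltnW.
have [x0 _] := card_gt0P T_gt0.
have aE : alpha G [set: T] = a by apply: alpha_setT.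
have a_gt0 : 0 < a by rewrite -aE (alpha_gt0 irr (in_setT x0)).
have lt_an : alpha G [set: T] < #|[set: T]|.
  by apply: cut_connected_alpha_lt; rewrite ?cardsT.
have fE : f_TC n a = tconn n a.
  by rewrite f_TC_closed // a_gt0 /n -cardsT -aE ltnW.
have [|le_f eq_f] := fib_le_tconn sym irr _ conn; first by rewrite -card_gt0.
rewrite /fib_bounded fib_setT aE cardsT -/n -fE in le_f eq_f.
have hub_iso : fib_index G = f_TC n a -> has_hub G [set: T] -> graph_iso G (TC_graph n a).
  move=> E [x xT hub].
  have [|c [i0 shape]] := tc_structure sym irr conn xT lt_an _ hub.
    by rewrite fib_setT cardsT aE -/n -fE.
  by rewrite aE in shape; apply: tc_shape_iso shape.
split=> //; split=> [ne52|E52]; split.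
- move=> E; have [|[cT a2 _]] := eq_f E; first exact: hub_iso.
  by case: ne52; rewrite /n -cardsT cT -aE a2.
- exact: fib_index_iso.
- move=> E; have [H|[_ _ [f [f_inj fG]]]] := eq_f E.
    by left; have := hub_iso E H; case: E52 => -> ->.
  right; exists f; split=> [|x y]; last exact: fG.
  apply: inj_card_bij => [x y|]; first exact: f_inj.
  by rewrite card_ord; case: E52 => <-.
- case=> H; rewrite (fib_index_iso H); case: E52 => -> -> //.
  (* For n = 5 and a = 2 the closed form gives 9 + 2 = 11, the count for the 5-cycle. *)
  by rewrite fib_C5 f_TC_closed.
Qed.
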